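(* Let $\mathcal{P}\subset\mathbb{R}[x]$ be a finite-dimensional affine family of polynomials, and let $\varepsilon\colon\mathbb{N}\to(0,\infty)$ be such that $\frac{\log (1/\varepsilon(n))}{\log n}\to 0$ as $n\to\infty$. Then at least one of the following holds: (1) For all $p\in\mathcal{P}$ we have $\deg p\le 2$. (2) There is $p\in\mathcal{P}$ such that for all $q\in\mathcal{P}$ we have $\deg p>\deg(p-q)$. (3) For all $p\in\mathcal{P}$ except for a set of measure $0$, the set $\mathcal{A}_\varepsilon^p=\{n\in\mathbb{N} : \|p(n)\|_{\mathbb{R}/\mathbb{Z}}\le\varepsilon(n)\}$ is a basis of order $2$.
   Context: $\mathbb{N}=\{0,1,2,\dots\}$ and $\|t\|_{\mathbb{R}/\mathbb{Z}}=\min_{n\in\mathbb{Z}}|t-n|$. A set $\mathcal{A}\subset\mathbb{N}$ is a basis of order $2$ if $2\mathcal{A}=\{n_1+n_2 : n_1,n_2\in\mathcal{A}\}$ contains all sufficiently large integers. An affine family of polynomials is an affine subspace $\mathcal{P}$ of the $\mathbb{R}$-vector space $\mathbb{R}[x]$; it carries a canonical Haar (Lebesgue) measure, defined up to a constant factor, and ''measure $0$'' refers to this measure. The zero polynomial has degree $-\infty$. *)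

(* Defs.v *)
From HB Require Import structures.
From mathcomp Require Import all_boot all_order all_algebra.
From mathcomp Require Import all_classical all_reals all_analysis.

Set Implicit Arguments.
Unset Strict Implicit.
Unset Printing Implicit Defensive.

Import Order.TTheory GRing.Theory Num.Theory.
Import numFieldNormedType.Exports.

Local Open Scope classical_set_scope.
Local Open Scope ring_scope.

(* The infimum is attained, so it is a minimum. *)
Definition dist_int (R : realType) (t : R) : R :=
  inf [set `|t - k%:~R| | k in [set: int]].

Definition sumset2 (A : set nat) : set nat := [set (m + n)%N | m in A & n in A].

Definition basis_of_order2 (A : set nat) : Prop :=
  \forall n \near \oo, sumset2 A n.

Definition small_dist_set (R : realType) (eps : nat -> R) (p : {poly R}) :
    set nat :=
  [set n | dist_int p.[n%:R] <= eps n].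

(* Restated because the library's instance for a product of finite measures
   hides its sigma-finite instance. *)
Lemma product_measure1_sigma_finite d1 d2 (T1 : measurableType d1)
    (T2 : measurableType d2) (R : realType)
    (m1 : {sigma_finite_measure set T1 -> \bar R})
    (m2 : {sigma_finite_measure set T2 -> \bar R}) :
  sigma_finite setT (m1 \x m2)%E.
Proof.
have /sigma_finiteP[F [TF ndF Foo]] := sigma_finiteT m1.
have /sigma_finiteP[G [TG ndG Goo]] := sigma_finiteT m2.
exists (fun n => F n `*` G n).
  rewrite -setXTT TF TG predeqE => -[x y]; split.
    move=> [/= [n _ Fnx] [k _ Gky]]; exists (maxn n k) => //; split.
    - by move: x Fnx; exact/subsetPset/ndF/leq_maxl.
    - by move: y Gky; exact/subsetPset/ndG/leq_maxr.
  by move=> [n _ []/= ? ?]; split; exists n.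
move=> k; have [? ?] := Foo k; have [? ?] := Goo k.
split; first exact: measurableX.
by rewrite product_measure1E// lte_mul_pinfty// ge0_fin_numE.
Qed.

Section pushforward_sigma_finite.
Context d d' (T : measurableType d) (T' : measurableType d') (R : realType).
Variables (m : {measure set T -> \bar R}) (f : T -> T') (g : T' -> T).
Hypothesis m_sigma_finite : sigma_finite setT m.
Hypotheses (mf : measurable_fun setT f) (mg : measurable_fun setT g).
Hypothesis fK : cancel f g.

Let nu := pushforward m f.

Let nu0 : nu set0 = 0%E.
Proof. by rewrite /nu /pushforward preimage_set0 measure0. Qed.

Let nu_ge0 A : (0 <= nu A)%E.
Proof. exact: measure_ge0. Qed.

Let nu_sigma_additive : semi_sigma_additive nu.
Proof. exact: (@measure_semi_sigma_additive _ _ _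
  (measure_function_pushforward__canonical__measure_function_Measure m mf)).
Qed.

HB.instance Definition _ := isMeasure.Build _ _ _ nu
  nu0 nu_ge0 nu_sigma_additive.

Let nu_sigma_finite : sigma_finite setT nu.
Proof.
have [F FT Foo] := m_sigma_finite.
exists (fun k => g @^-1` F k).
  by rewrite -preimage_bigcup -FT preimage_setT.
move=> k; have [mF Fk] := Foo k; split.
  by rewrite -[X in measurable X]setTI; exact: mg.
rewrite /nu /pushforward (_ : _ @^-1` _ = F k)//.
by apply/seteqP; split=> z; rewrite /= fK.
Qed.

HB.instance Definition _ := Measure_isSigmaFinite.Build _ _ _ nu nu_sigma_finite.

Lemma pushforward_sigma_finite :
  exists mu : {sigma_finite_measure set T' -> \bar R},
    (mu : set T' -> \bar R) = pushforward m f.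
Proof. by exists nu. Qed.

End pushforward_sigma_finite.

Section lebesgue_tuple.
Variable R : realType.
Local Notation RT := (measurableTypeR R).

Definition cons_pair n (z : RT * n.-tuple RT) : n.+1.-tuple RT :=
  [tuple of z.1 :: z.2].

Definition uncons n (v : n.+1.-tuple RT) : RT * n.-tuple RT :=
  (thead v, [tuple of behead v]).

Lemma cons_pairK n : cancel (@cons_pair n) (@uncons n).
Proof.
by case=> x v; rewrite /cons_pair /uncons; congr pair; apply: val_inj.
Qed.

Lemma measurable_cons_pair n : measurable_fun setT (@cons_pair n).
Proof. exact: measurable_cons. Qed.

Lemma measurable_uncons n : measurable_fun setT (@uncons n).
Proof.
apply: measurable_fun_pair; first exact: measurable_tnth.
exact: measurable_behead.
Qed.

(* n-dimensional Lebesgue measure: the n-fold product of [lebesgue_measure],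
   transported to n.-tuple R; for n = 0 it is the unit mass at the point. *)
Fixpoint lebesgue_tuple n : set (n.-tuple RT) -> \bar R :=
  match n with
  | 0 => \d_[tuple]
  | m.+1 => pushforward (@lebesgue_measure R \x @lebesgue_tuple m)%E
              (@cons_pair m)
  end.

Lemma lebesgue_tuple_measure n :
  exists mu : {sigma_finite_measure set (n.-tuple RT) -> \bar R},
    (mu : set _ -> \bar R) = @lebesgue_tuple n.
Proof.
elim: n => [|n [mu muE]]; first by eexists (\d_[tuple]).
have [nu nuE] := pushforward_sigma_finite
  (product_measure1_sigma_finite (@lebesgue_measure R) mu)
  (@measurable_cons_pair n) (@measurable_uncons n) (@cons_pairK n).
by exists nu; rewrite nuE /= -muE.
Qed.

Section instances.
Variable n : nat.

Let lebesgue_tuple0 : lebesgue_tuple (set0 : set (n.-tuple RT)) = 0%E.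
Proof. by have [mu <-] := lebesgue_tuple_measure n; rewrite measure0. Qed.

Let lebesgue_tuple_ge0 (A : set (n.-tuple RT)) : (0 <= lebesgue_tuple A)%E.
Proof. by have [mu <-] := lebesgue_tuple_measure n; exact: measure_ge0. Qed.

Let lebesgue_tuple_sigma_additive : semi_sigma_additive (@lebesgue_tuple n).
Proof.
have [mu <-] := lebesgue_tuple_measure n.
exact: measure_semi_sigma_additive.
Qed.

HB.instance Definition _ := isMeasure.Build _ _ _ (@lebesgue_tuple n)
  lebesgue_tuple0 lebesgue_tuple_ge0 lebesgue_tuple_sigma_additive.

Let lebesgue_tuple_sigma_finite : sigma_finite setT (@lebesgue_tuple n).
Proof. by have [mu <-] := lebesgue_tuple_measure n; exact: sigma_finiteT. Qed.

HB.instance Definition _ := Measure_isSigmaFinite.Build _ _ _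
  (@lebesgue_tuple n) lebesgue_tuple_sigma_finite.

End instances.

Lemma measurable_tuple_box n (A : 'I_n -> set RT) :
  (forall i, measurable (A i)) ->
  measurable [set v : n.-tuple RT | forall i, A i (tnth v i)].
Proof.
move=> mA.
rewrite (_ : [set v | _] = \bigcap_(i in [set: 'I_n]) ((@tnth n RT)^~ i @^-1` A i)).
  apply: fin_bigcap_measurable; first exact: finite_finset.
  by move=> i _; rewrite -[X in measurable X]setTI; exact: measurable_tnth.
by apply/seteqP; split=> v /= vA i; [move=> _|]; exact: vA.
Qed.

Lemma lebesgue_tuple_box n (A : 'I_n -> set RT) :
  (forall i, measurable (A i)) ->
  lebesgue_tuple [set v : n.-tuple RT | forall i, A i (tnth v i)] =
  (\prod_(i < n) @lebesgue_measure R (A i))%E.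
Proof.
elim: n A => [A _|n IH A mA].
  rewrite big_ord0 /= diracE (_ : (_ \in _) = true)//.
  by apply/mem_set => -[].
rewrite big_ord_recl -IH => [|i]; last exact: mA.
have mB := measurable_tuple_box (fun i => mA (lift ord0 i)).
rewrite /= -(product_measure1E _ _ (mA ord0) mB).
rewrite [X in _ = _ X](_ : _ = @cons_pair n @^-1`
  [set v : n.+1.-tuple RT | forall i, A i (tnth v i)])//.
apply/seteqP; split=> -[x v] /=.
  move=> [Ax Av] i; have [j ->|->//] := unliftP ord0 i.
  by rewrite tnthS; exact: Av.
move=> xvA; split=> [|i]; first exact: (xvA ord0).
by have := xvA (lift ord0 i); rewrite tnthS.
Qed.

End lebesgue_tuple.

Section affine_family.
Variable R : realType.
Implicit Types (P : set {poly R}) (n : nat).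

Definition affine_point n (p0 : {poly R}) (b : 'I_n -> {poly R})
    (t : n.-tuple (measurableTypeR R)) : {poly R} :=
  p0 + \sum_(i < n) tnth t i *: b i.

Definition linearly_independent n (b : 'I_n -> {poly R}) : Prop :=
  forall c : 'I_n -> R, \sum_(i < n) c i *: b i = 0 -> forall i, c i = 0.

(* P is the translate by p0 of the linear span of the independent family b. *)
Definition affine_frame P n (p0 : {poly R}) (b : 'I_n -> {poly R}) : Prop :=
  linearly_independent b /\ P = range (affine_point p0 b).

Definition findim_affine_family P : Prop :=
  exists n p0 (b : 'I_n -> {poly R}), affine_frame P p0 b.

(* The Haar measure of P is, up to a constant factor, the image of the Lebesgue
   measure under the affine coordinates given by a frame. Two frames of P differ
   by an affine automorphism of R^n, so a property that holds almost everywhere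
   in one frame does so in every frame. *)
Definition haar_almost_all P (Q : set {poly R}) : Prop :=
  forall n p0 (b : 'I_n -> {poly R}), affine_frame P p0 b ->
    {ae @lebesgue_tuple R n, forall t, Q (affine_point p0 b t)}.

End affine_family.

(* Main.v *)
Require Import Defs.
From mathcomp Require Import all_boot all_order all_algebra.
From mathcomp Require Import all_classical all_reals all_analysis.
From mathcomp Require Import measurable_realfun polyorder polyrcf ring lra zify.

(* If neither of the first two alternatives holds, the direction space of the
   family contains a polynomial of degree at least 3, hence so does every basis
   of it; call such a basis vector b. By Fubini it suffices to fix all the other
   coordinates and to treat the line s |-> f + s b, for an arbitrary function f.

   A representation N = n + (N - n) with both values close to integers exists as
   soon as the sums S(k, l) of e(k p(n) + l p(N - n)) over n in [M, 2M) are
   slightly smaller than trivial, for (k, l) <> (0, 0) and k, l at most a small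
   power of N. The fourth moment of S(k, l) with respect to s counts the
   near-solutions of phi(a) - phi(a') = phi(b) - phi(b') with
   phi(n) = k b(n) + l b(N - n). Since b has degree at least 3, phi is uniformly
   convex or concave even when its leading terms cancel, and confining a and a'
   to a common short block saves a power of M over the trivial count. The set of
   bad s therefore has measure O(N^(-1-c)), and Borel-Cantelli concludes. *)

Import Order.TTheory GRing.Theory Num.Theory.
Import numFieldNormedType.Exports.

Local Open Scope ring_scope.

(** * Counting near-solutions and the fourth moment *)

Section counting.
Context {R : realType}.

Lemma card_fiber_le (T U : finType) (A : {set T}) (B : {set U}) (f : T -> U)
    (D : R) : (forall t, t \in A -> f t \in B) ->
  (forall u, u \in B -> #|[set t in A | f t == u]|%:R <= D) ->
  #|A|%:R <= #|B|%:R * D.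
Proof.
move=> fAB fD.
have -> : #|A| = (\sum_(u in B) #|[set t in A | f t == u]|)%N.
  rewrite -sum1_card (partition_big f (mem B))//=.
  by apply: eq_bigr => u _; rewrite -sum1_card; apply: eq_bigl => t; rewrite inE.
rewrite natr_sum mulr_natl -sumr_const; exact: ler_sum.
Qed.

(** Only the smallest and the largest index in [A] matter: their values under [psi] differ by at
    most [2 * W], so the separation bounds the index span by [2 * W / g], and injectivity of [idx]
    bounds [#|A|] by the span plus one. *)
Lemma card_separated (T : finType) (A : {set T}) (idx : T -> nat) (psi : T -> R)
    (y W g : R) : 0 <= W -> 0 < g -> {in A &, injective idx} ->
  (forall s t, s \in A -> t \in A -> (idx s < idx t)%N ->
     g * ((idx t)%:R - (idx s)%:R) <= `|psi t - psi s|) ->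
  (forall t, t \in A -> `|psi t - y| <= W) ->
  #|A|%:R <= 2 * W / g + 1.
Proof.
move=> W0 g0 inj sep near.
have [->|[t0 t0A]] := set_0Vmem A.
  by rewrite cards0 addr_ge0// divr_ge0 ?mulr_ge0// ltW.
case: (arg_minnP idx t0A) => a aA amin; case: (arg_maxnP idx t0A) => b bA bmax.
have ab : (idx a <= idx b)%N := amin _ bA.
have cardA : (#|A| <= (idx b - idx a).+1)%N.
  rewrite cardE -(size_map idx) -[leqRHS](size_iota (idx a)).
  apply: uniq_leq_size => [|_ /mapP[t tA ->]].
    rewrite map_inj_in_uniq ?enum_uniq// => s t.
    by rewrite !mem_enum; exact: inj.
  rewrite mem_enum in tA; rewrite mem_iota amin//=.
  have := bmax _ tA; rewrite /= => h.
  by rewrite addnS ltnS subnKC.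
apply: (@le_trans _ _ ((idx b - idx a).+1%:R)); first by rewrite ler_nat.
rewrite -natr1 lerD2r natrB// ler_pdivlMr// mulrC.
move: ab; rewrite leq_eqVlt => /orP[/eqP->|ab].
  by rewrite subrr mulr0 mulr_ge0.
apply: (le_trans (sep _ _ aA bA ab)).
have -> : psi b - psi a = (psi b - y) - (psi a - y) by ring.
apply: (le_trans (ler_normB _ _)).
have := near _ aA; have := near _ bA; lra.
Qed.

Variables (M G : nat) (phi : nat -> R) (g g1 g2 W : R).
Hypotheses (g_gt0 : 0 < g) (g1_gt0 : 0 < g1) (W_ge0 : 0 <= W) (G_gt0 : (0 < G)%N).
Hypothesis phi_lower : forall a b, (a < b < M)%N ->
  g1 * (b%:R - a%:R) <= `|phi b - phi a|.
Hypothesis phi_upper : forall a b, (a < b < M)%N ->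
  `|phi b - phi a| <= g2 * (b%:R - a%:R).
Hypothesis phi_convex : forall a b u, (a < b)%N -> (0 < u)%N -> (b + u < M)%N ->
  g * (b%:R - a%:R) <= `|phi (b + u)%N - phi b - (phi (a + u)%N - phi a)|.

Definition quad := (('I_M * 'I_M) * ('I_M * 'I_M))%type.

Definition same_block (p : 'I_M * 'I_M) := (p.1 %/ G == p.2 %/ G)%N.

Definition quad_gap (q : quad) : R :=
  phi q.1.1 - phi q.1.2 - (phi q.2.1 - phi q.2.2).

(** Only the pair [q.1] is confined to a block; [q.2] ranges freely. This matches the one-sided use
    of Cauchy-Schwarz in [quartic_sum_cos_le]. *)
Definition near_quads : {set quad} :=
  [set q | same_block q.1 && (`|quad_gap q| <= W)].

Lemma same_blockP (a b : 'I_M) : same_block (a, b) -> (a < b + G)%N /\ (b < a + G)%N.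
Proof.
rewrite /same_block /= => /eqP e.
have := divn_eq a G; have := divn_eq b G; rewrite e.
have := ltn_pmod a G_gt0; have := ltn_pmod b G_gt0.
move: (_ %/ _)%N (a %% G)%N (b %% G)%N => k r s; lia.
Qed.

Lemma phi_lower_norm (a b : 'I_M) : (a < b)%N ->
  g1 * (b%:R - a%:R) <= `|phi b - phi a|.
Proof. by move=> ab; apply: phi_lower; rewrite ab ltn_ord. Qed.

Lemma card_close_pairs (Z : R) : 0 <= Z ->
  #|[set p : 'I_M * 'I_M | `|phi p.1 - phi p.2| <= Z]|%:R
    <= M%:R * (2 * Z / g1 + 1).
Proof.
move=> Z0; rewrite -[in leRHS](card_ord M) -[in leRHS]cardsT.
apply: (@card_fiber_le _ _ _ _ fst) => // b _.
apply: (@card_separated ('I_M * 'I_M)%type _ (fun p => p.2 : nat) (fun p => phi p.2) (phi b)) => //.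
- by move=> [x s] [y t]; rewrite !inE /= => /andP[_ /eqP->] /andP[_ /eqP->] /val_inj->.
- by move=> s t _ _; exact: phi_lower_norm.
- by move=> [x t]; rewrite !inE /= distrC => /andP[h /eqP <-].
Qed.

(** When the first pair is diagonal the gap reduces to the difference of [phi] at the second pair.
    So three of the four entries are determined by [(q.1.1, q.2.1)], and the last one lies in a
    window of radius [W]. *)
Lemma card_diagonal_quads :
  #|[set q in near_quads | q.1.1 == q.1.2]|%:R <= M%:R ^+ 2 * (2 * W / g1 + 1).
Proof.
have -> : M%:R ^+ 2 = #|[set: 'I_M * 'I_M]|%:R :> R.
  by rewrite cardsT card_prod card_ord natrM expr2.
apply: (@card_fiber_le _ _ _ _ (fun q => (q.1.1, q.2.1))) => // -[a b] _.
apply: (@card_separated quad _ (fun q => q.2.2 : nat) (fun q => phi q.2.2) (phi b)) => //.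
- move=> [[x x'] [s s']] [[y y'] [t t']]; rewrite !inE /=.
  move=> /andP[/andP[_ /eqP->] /eqP[-> ->]] /andP[/andP[_ /eqP<-] /eqP[-> ->]].
  by move=> /val_inj->.
- by move=> s t _ _; exact: phi_lower_norm.
- move=> [[x x'] [s s']]; rewrite !inE /= /quad_gap /=.
  move=> /andP[/andP[/andP[_ h] /eqP e] /eqP[_ <-]].
  by rewrite -e subrr sub0r normrN in h; rewrite distrC.
Qed.

(** Write [q] as [((a, a'), (b, b'))]. Fix the shift [a' - a] (fewer than [2 * G] values) and the
    pair [(b, b')]. By [phi_convex], the increments [phi a - phi a'] with a fixed nonzero shift are
    separated in [a], so few of them fall in a window of radius [W]. Since [a] and [a'] share a
    block, [phi a - phi a'] is at most [g2 * G]; this forces [phi b] and [phi b'] to be close and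
    limits the pairs [(b, b')]. *)
Lemma card_offdiagonal_quads : 0 <= g2 ->
  #|[set q in near_quads | q.1.1 != q.1.2]|%:R <=
    (2 * G%:R) * (M%:R * (2 * (W + g2 * G%:R) / g1 + 1)) * (2 * W / g + 1).
Proof.
move=> g20.
set Z := W + g2 * G%:R.
have Z0 : 0 <= Z by rewrite addr_ge0// mulr_ge0.
pose N := [set p : 'I_M * 'I_M | `|phi p.1 - phi p.2| <= Z].
have GK : (2 * G).-1.+1 = (2 * G)%N by rewrite prednK//; lia.
apply: (@le_trans _ _ (#|finset.setX (finset.setTfor 'I_(2 * G).-1.+1) N|%:R * (2 * W / g + 1))); last first.
  apply: ler_wpM2r; first by rewrite addr_ge0// divr_ge0 ?mulr_ge0// ltW.
  rewrite cardsX cardsT card_ord GK natrM natrM.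
  by apply: ler_wpM2l; [rewrite mulr_ge0|exact: card_close_pairs].
(* The signed shift is stored as [a' + G - a]: within a block the truncated subtraction is exact and
   the result lies strictly between 0 and [2 * G], so [inord] never falls back to its default. The
   value [G] would mean [a = a']. *)
pose f (q : quad) : 'I_(2 * G).-1.+1 * ('I_M * 'I_M) :=
  (inord (q.1.2 + G - q.1.1), q.2).
apply: (@card_fiber_le _ _ _ _ f) => [[[a a'] [b b']]|[u [b b']] _].
  rewrite !inE /= /quad_gap /= => /andP[/andP[/same_blockP[h1 h2] h] aa].
  have : `|phi a - phi a'| <= g2 * G%:R.
    have key (x y : 'I_M) : (x < y)%N -> (y < x + G)%N -> `|phi y - phi x| <= g2 * G%:R.
      move=> xy yx; apply: (le_trans (phi_upper _ _ _)); first by rewrite xy ltn_ord.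
      by rewrite ler_wpM2l// -natrB ?(ltnW xy)// ler_nat; lia.
    have [lt|lt|e] := ltngtP a a'; first by rewrite distrC key.
    - exact: key.
    - by move: aa; rewrite -val_eqE /= e eqxx.
  have -> : phi b - phi b' = (phi a - phi a') - (phi a - phi a' - (phi b - phi b')) by ring.
  by move=> h'; apply: (le_trans (ler_normB _ _)); rewrite /Z; lra.
have uP (q : quad) : q \in [set t in [set q in near_quads | q.1.1 != q.1.2] |
    f t == (u, (b, b'))] ->
   [/\ (q.1.2 + G = q.1.1 + u)%N, u != G :> nat, q.2 = (b, b') & `|quad_gap q| <= W].
  case: q => [[a a'] [c c']]; rewrite !inE /= /f /=.
  move=> /andP[/andP[/andP[/same_blockP[h1 h2] h] aa] /eqP[e1 cb cb']]; rewrite cb cb' in h *.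
  have e : (a' + G - a = u)%N by rewrite -e1 inordK//; lia.
  split=> //; first by lia.
  by apply: contra aa => /eqP e'; rewrite -val_eqE /=; apply/eqP; lia.
apply: (@card_separated quad _ (fun q => q.1.1 : nat)
    (fun q => phi q.1.1 - phi q.1.2) (phi b - phi b')) => //.
- move=> [[a a'] c] [[d d'] c'] /uP[/= e1 _ -> _] /uP[/= e2 _ -> _] e3.
  have e4 : a' = d' :> nat by lia.
  by rewrite (val_inj e3) (val_inj e4).
- move=> [[a a'] c] [[d d'] c'] /uP[/= e1 n1 _ _] /uP[/= e2 n2 _ _] ad.
  (* The sign of the shift decides whether [a'] or [a] is the base point of the increment in
     [phi_convex]. *)
  have [uG|uG|] := ltngtP u G; last by move=> e; rewrite e eqxx in n1.
    have ea : (a = a' + (G - u) :> nat)%N by lia.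
    have ed : (d = d' + (G - u) :> nat)%N by lia.
    rewrite ea ed; have -> : (d' + (G - u))%:R - (a' + (G - u))%:R = d'%:R - a'%:R :> R.
      by rewrite !natrD; ring.
    by apply: phi_convex; [lia|lia|rewrite -ed].
  have ea : (a' = a + (u - G) :> nat)%N by lia.
  have ed : (d' = d + (u - G) :> nat)%N by lia.
  rewrite ea ed.
  have -> : phi d - phi (d + (u - G))%N - (phi a - phi (a + (u - G))%N) =
    - (phi (d + (u - G))%N - phi d - (phi (a + (u - G))%N - phi a)) by ring.
  by rewrite normrN; apply: phi_convex; [lia|lia|rewrite -ed].
- by move=> q /uP[_ _ e]; rewrite /quad_gap e.
Qed.

Lemma card_near_quads : 0 <= g2 ->
  #|near_quads|%:R <= M%:R ^+ 2 * (2 * W / g1 + 1) +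
    (2 * G%:R) * (M%:R * (2 * (W + g2 * G%:R) / g1 + 1)) * (2 * W / g + 1).
Proof.
move=> g20.
have -> : #|near_quads| = (#|[set q in near_quads | q.1.1 == q.1.2]| +
   #|[set q in near_quads | q.1.1 != q.1.2]|)%N.
  rewrite -(cardsID [set q : quad | q.1.1 == q.1.2] near_quads).
  by congr (_ + _)%N; apply: eq_card => q; rewrite !inE// andbC.
by rewrite natrD lerD ?card_diagonal_quads// card_offdiagonal_quads.
Qed.

Lemma card_same_block : #|[set p | same_block p]|%:R <= M%:R * G%:R :> R.
Proof.
rewrite -[in leRHS](card_ord M) -[in leRHS]cardsT.
apply: (@card_fiber_le _ _ _ _ fst) => // a _.
rewrite ler_nat cardE -(size_map (fun p : 'I_M * 'I_M => p.2 : nat)).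
rewrite -(size_iota (a %/ G * G) G).
apply: uniq_leq_size => [|_ /mapP[[x y] + ->]].
  rewrite map_inj_in_uniq ?enum_uniq// => -[x s] [y t].
  by rewrite !mem_enum !inE /= => /andP[_ /eqP->] /andP[_ /eqP->] /val_inj->.
rewrite mem_enum !inE /= /same_block /= => /andP[/eqP e /eqP xa].
rewrite mem_iota -xa e leq_trunc_div /= [in ltnLHS](divn_eq y G) ltn_add2l.
exact: ltn_pmod.
Qed.

End counting.

(** * The fourth power of a cosine sum as a sum over quadruples *)

Section quartic.
Context {R : realType}.
Variables (M G B : nat).
Hypotheses (G_gt0 : (0 < G)%N) (MBG : M = (B * G)%N).

Lemma sqr_sum_le (n : nat) (X : 'I_n -> R) :
  (\sum_i X i) ^+ 2 <= n%:R * \sum_i X i ^+ 2.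
Proof.
have : 0 <= \sum_i \sum_j (X i - X j) ^+ 2.
  by apply: sumr_ge0 => i _; apply: sumr_ge0 => j _; exact: sqr_ge0.
under eq_bigr do under eq_bigr do rewrite sqrrB.
under eq_bigr do rewrite big_split sumrB /= sumr_const card_ord.
rewrite big_split sumrB /= sumr_const card_ord sumrMnl.
have -> : \sum_i \sum_j X i * X j *+ 2 = (\sum_i X i) ^+ 2 *+ 2.
  rewrite expr2 mulr_suml -sumrMnl; apply: eq_bigr => i _.
  by rewrite mulr_sumr -sumrMnl.
rewrite -mulr_natl => h; lra.
Qed.

(** Cauchy-Schwarz over the [B] block sums; expanding the square of each block sum produces exactly
    the pairs in a common block. *)
Lemma sqr_sum_blocks_le (x : 'I_M -> R) :
  (\sum_n x n) ^+ 2 <=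
  B%:R * \sum_(p : 'I_M * 'I_M | same_block M G p) x p.1 * x p.2.
Proof.
have lt (n : 'I_M) : (n %/ G < B)%N by rewrite ltn_divLR// -MBG.
pose h (n : 'I_M) : 'I_B := Ordinal (lt n).
have -> : \sum_n x n = \sum_(i < B) \sum_(n | h n == i) x n.
  by rewrite (partition_big h xpredT).
apply: (le_trans (sqr_sum_le _ _)); rewrite ler_wpM2l//.
under eq_bigr do rewrite expr2 mulr_suml.
rewrite -(pair_big_dep xpredT (fun a b => same_block M G (a, b))
  (fun a b => x a * x b)) /=.
rewrite le_eqVlt; apply/orP; left; apply/eqP.
rewrite [RHS](partition_big h xpredT)//=.
apply: eq_bigr => i _; apply: eq_bigr => n /eqP <-.
by rewrite mulr_sumr; apply: eq_bigl => m; rewrite eq_sym.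
Qed.

Lemma sqr_sum_cos_sin (I : finType) (th : I -> R) :
  (\sum_n cos (th n)) ^+ 2 + (\sum_n sin (th n)) ^+ 2 =
  \sum_(p : I * I) cos (th p.1 - th p.2).
Proof.
rewrite -(pair_big xpredT xpredT (fun a b => cos (th a - th b))) /=.
rewrite !expr2 !mulr_suml -big_split; apply: eq_bigr => a _ /=.
by rewrite !mulr_sumr -big_split; apply: eq_bigr => b _; rewrite /= cosB.
Qed.

(** Swapping the two indices changes the sign. This removes the sine part when a cosine of a
    difference is expanded, so that real sums can stand in for the complex ones. *)
Lemma sum_sin_antisym (I : finType) (th : I -> R) :
  \sum_(p : I * I) sin (th p.1 - th p.2) = 0.
Proof.
rewrite -(pair_big xpredT xpredT (fun a b => sin (th a - th b))) /=.
have : \sum_a \sum_b sin (th a - th b) = - \sum_a \sum_b sin (th a - th b).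
  rewrite {2}exchange_big -sumrN; apply: eq_bigr => a _.
  by rewrite -sumrN; apply: eq_bigr => b _; rewrite -sinN opprB.
lra.
Qed.

(* Cauchy-Schwarz over the blocks is applied to only one of the two factors
   [|S|^2 = C^2 + D^2]; this is what saves a power over the trivial bound. *)
Lemma quartic_sum_cos_le (th : 'I_M -> R) :
  (\sum_n cos (th n)) ^+ 4 <= B%:R * \sum_(q : quad M | same_block M G q.1)
    cos (th q.1.1 - th q.1.2 - (th q.2.1 - th q.2.2)).
Proof.
set C := \sum_n cos (th n); set D := \sum_n sin (th n).
have CD0 : 0 <= C ^+ 2 + D ^+ 2 by rewrite addr_ge0 ?sqr_ge0.
apply: (@le_trans _ _ ((C ^+ 2 + D ^+ 2) * (C ^+ 2 + D ^+ 2))).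
  rewrite (_ : 4 = 2 * 2)%N// exprM [leLHS]expr2.
  by apply: ler_pM; rewrite ?lerDl ?sqr_ge0.
have blk : C ^+ 2 + D ^+ 2 <=
    B%:R * \sum_(p : 'I_M * 'I_M | same_block M G p) cos (th p.1 - th p.2).
  have := sqr_sum_blocks_le (fun n => cos (th n)).
  have := sqr_sum_blocks_le (fun n => sin (th n)).
  move=> hs hc; apply: (le_trans (lerD hc hs)).
  rewrite -mulrDr -big_split ler_wpM2l//= ler_sum// => p _.
  by rewrite cosB.
apply: (le_trans (ler_wpM2r CD0 blk)); rewrite -mulrA ler_wpM2l//.
rewrite sqr_sum_cos_sin.
have -> : \sum_(q : quad M | same_block M G q.1)
      cos (th q.1.1 - th q.1.2 - (th q.2.1 - th q.2.2)) =
    \sum_(p | same_block M G p) \sum_(r : 'I_M * 'I_M)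
      cos (th p.1 - th p.2 - (th r.1 - th r.2)).
  by rewrite pair_big_dep; apply: eq_bigl => q; rewrite andbT.
rewrite mulr_suml; apply: ler_sum => p _.
under [leRHS]eq_bigr do rewrite cosB.
by rewrite big_split /= -!mulr_sumr sum_sin_antisym mulr0 addr0.
Qed.

End quartic.

Local Open Scope classical_set_scope.
Local Open Scope ring_scope.

(** * Detection of simultaneous small values *)

Section detection.
Context {R : realType}.
Implicit Types x y z : R.

(** The real form of the binomial expansion of [(e^(ix) + e^(-ix))^n e^(iy)]. The induction uses the
    product-to-sum formula and Pascal's rule. *)
Lemma expr_cos_mul_cos (n : nat) x y :
  (2 * cos x) ^+ n * cos y =
  \sum_(i < n.+1) 'C(n, i)%:R * cos (y + (n%:R - 2 * i%:R) * x).
Proof.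
elim: n y => [|n IH] y.
  by rewrite big_ord1 bin0 expr0; congr (_ * cos _); rewrite /=; ring.
rewrite exprSr -mulrA (_ : 2 * cos x * cos y = cos (y + x) + cos (y - x)); last first.
  by rewrite cosD cosB; ring.
pose T k := cos (y + (n.+1%:R - 2 * k%:R) * x).
rewrite mulrDr !IH -[LHS]/(_ + _).
have -> : \sum_(i < n.+1) 'C(n, i)%:R * cos (y + x + (n%:R - 2 * i%:R) * x) =
    \sum_(i < n.+1) 'C(n, i)%:R * T i.
  by apply: eq_bigr => i _; congr (_ * cos _); rewrite -natr1; ring.
have -> : \sum_(i < n.+1) 'C(n, i)%:R * cos (y - x + (n%:R - 2 * i%:R) * x) =
    \sum_(i < n.+1) 'C(n, i)%:R * T i.+1.
  by apply: eq_bigr => i _; congr (_ * cos _); rewrite -!natr1; ring.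
rewrite -[RHS]/(\sum_(i < n.+2) 'C(n.+1, i)%:R * T i) [RHS]big_ord_recl /=.
under [in RHS]eq_bigr do rewrite /bump add1n binS natrD mulrDl.
rewrite big_split /= addrA; congr (_ + _).
rewrite big_ord_recl [in RHS]big_ord_recr /=.
by rewrite /bump (bin_small (ltnSn n)) mulr0n mul0r addr0 !bin0.
Qed.

(** Induction through the ratio of consecutive central binomials, [2 * (2 * n + 1) / (n + 1)]. *)
Lemma central_bin_ge (n : nat) : (4 ^ n <= (2 * n).+1 * 'C(2 * n, n))%N.
Proof.
elim: n => // n IH.
have E : (n.+1 * 'C(2 * n.+1, n.+1) = 2 * (2 * n).+1 * 'C(2 * n, n))%N.
  have e1 := mul_bin_diag (2 * n).+2 n.
  have e2 := mul_bin_down (2 * n).+1 n.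
  have -> : (2 * n.+1 = (2 * n).+2)%N by lia.
  have f : ((2 * n).+1 - n = n.+1)%N by lia.
  move: e1 e2; rewrite /= f => e1 e2.
  rewrite -e1; apply/eqP; rewrite -(eqn_pmul2l (ltn0Sn n)); apply/eqP; nia.
rewrite -(leq_pmul2l (ltn0Sn n)) expnS.
have -> : (n.+1 * ((2 * n.+1).+1 * 'C(2 * n.+1, n.+1)) =
  (2 * n.+1).+1 * (2 * (2 * n).+1 * 'C(2 * n, n)))%N by rewrite -E; ring.
nia.
Qed.

(* The weights below are the Fourier coefficients of [cos (pi x) ^+ (2 L)], a
   nonnegative kernel concentrated near the integers. *)
Definition cos_weight (L i : nat) : R := 'C(2 * L, i)%:R / 4 ^+ L.

Lemma cos_weight_ge0 L i : 0 <= cos_weight L i.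
Proof. by rewrite divr_ge0 ?exprn_ge0. Qed.

Lemma cos_weight_center L : ((2 * L).+1%:R)^-1 <= cos_weight L L.
Proof.
rewrite /cos_weight ler_pdivlMr ?exprn_gt0// mulrC ler_pdivrMr ?ltr0n//.
by rewrite -natrX -natrM ler_nat mulnC central_bin_ge.
Qed.

Lemma cos_kernelE L x z : cos (pi * x) ^+ (2 * L) * cos z =
  \sum_(i < (2 * L).+1)
     cos_weight L i * cos (z + 2 * pi * ((L%:R - i%:R) * x)).
Proof.
have := expr_cos_mul_cos (2 * L) (pi * x) z.
rewrite exprMn -mulrA => /(congr1 (fun t => t / 4 ^+ L)).
rewrite [in LHS]exprM (_ : 2 ^+ 2 = 4); last by ring.
rewrite mulrC mulKf ?expf_neq0// => ->.
rewrite mulr_suml; apply: eq_bigr => i _; rewrite /cos_weight mulrAC.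
by congr (_ * cos _); rewrite natrM; ring.
Qed.

Lemma sum_cos_weight L : \sum_(i < (2 * L).+1) cos_weight L i = 1.
Proof.
have := cos_kernelE L 0 0; rewrite mulr0 cos0 expr1n mulr1 => ->.
by apply: eq_bigr => i _; rewrite !mulr0 addr0 cos0 mulr1.
Qed.

Lemma cos_kernel2E L x y : cos (pi * x) ^+ (2 * L) * cos (pi * y) ^+ (2 * L) =
  \sum_(i < (2 * L).+1) \sum_(j < (2 * L).+1)
    cos_weight L i * cos_weight L j *
    cos (2 * pi * ((L%:R - i%:R) * x + (L%:R - j%:R) * y)).
Proof.
have e := cos_kernelE L y 0; rewrite cos0 mulr1 in e.
rewrite e mulr_sumr exchange_big; apply: eq_bigr => j _.
rewrite mulrCA cos_kernelE mulr_sumr; apply: eq_bigr => i _.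
by rewrite mulrA [_ * cos_weight _ i]mulrC; congr (_ * cos _); ring.
Qed.

(** Averaging the product kernel over [I], the zero frequency [i = j = L] contributes at least
    [(2 * L + 1)^-2 >= 2 * eta], while the other frequencies lose at most [eta] because the weights
    sum to 1. The average is thus at least [eta], and so is some term. *)
Lemma kernel_detection (I : finType) (L : nat) (x y : I -> R) (eta : R) :
  (0 < #|I|)%N -> 2 * eta * (2 * L).+1%:R ^+ 2 <= 1 ->
  (forall i j : 'I_(2 * L).+1, (i != L :> nat) || (j != L :> nat) ->
    `|\sum_n cos (2 * pi * ((L%:R - i%:R) * x n + (L%:R - j%:R) * y n))|
      <= eta * #|I|%:R) ->
  exists n, eta <= cos (pi * x n) ^+ (2 * L) * cos (pi * y n) ^+ (2 * L).
Proof.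
move=> I0 etaL small; apply: contrapT => /forallNP nlt.
have lt n : cos (pi * x n) ^+ (2 * L) * cos (pi * y n) ^+ (2 * L) < eta.
  by rewrite ltNge; apply/negP; exact: nlt.
pose S (i j : 'I_(2 * L).+1) :=
  \sum_n cos (2 * pi * ((L%:R - i%:R) * x n + (L%:R - j%:R) * y n)).
pose o := inord L : 'I_(2 * L).+1.
have oL : (o = L :> nat) by rewrite inordK//; lia.
pose w := cos_weight L.
have w0 i : 0 <= w i := cos_weight_ge0 L i.
have E : \sum_n cos (pi * x n) ^+ (2 * L) * cos (pi * y n) ^+ (2 * L) =
   \sum_(i < (2 * L).+1) \sum_(j < (2 * L).+1) w i * w j * S i j.
  under eq_bigr do rewrite cos_kernel2E.
  rewrite exchange_big; apply: eq_bigr => i _; rewrite exchange_big.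
  by apply: eq_bigr => j _; rewrite mulr_sumr.
have eta0 : 0 <= eta.
  case: (pickP I) => [n _|e]; last by rewrite (eq_card0 e) in I0.
  apply: le_trans (ltW (lt n)).
  by rewrite mulr_ge0// exprM exprn_ge0// sqr_ge0.
have Ioo : 0 < #|I|%:R :> R by rewrite ltr0n.
(* The error is subtracted at the central index too. This only weakens the bound there, and it lets
   the full double sum of weights collapse to 1. *)
have lower (i j : 'I_(2 * L).+1) : w i * w j * - (eta * #|I|%:R) +
    (if (i == o) && (j == o) then w L * w L * #|I|%:R else 0) <= w i * w j * S i j.
  case: ifPn => [/andP[/eqP-> /eqP->]|].
    rewrite oL -mulrDr ler_wpM2l ?mulr_ge0//.
    have -> : S o o = #|I|%:R.
      rewrite /S (eq_bigr (fun=> 1)) ?sumr_const// => n _.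
      by rewrite oL !subrr !mul0r addr0 mulr0 cos0.
    by rewrite gerDr oppr_le0 mulr_ge0// ltW.
  rewrite negb_and => nij; rewrite addr0 ler_wpM2l ?mulr_ge0// lerNl.
  have /small : (i != L :> nat) || (j != L :> nat).
    by move: nij; rewrite -!val_eqE /= oL.
  by apply: le_trans; rewrite -normrN ler_norm.
have : \sum_(i < (2 * L).+1) \sum_(j < (2 * L).+1)
   (w i * w j * - (eta * #|I|%:R) +
    (if (i == o) && (j == o) then w L * w L * #|I|%:R else 0)) <=
   \sum_n cos (pi * x n) ^+ (2 * L) * cos (pi * y n) ^+ (2 * L).
  by rewrite E; apply: ler_sum => i _; apply: ler_sum => j _; exact: lower.
have -> : \sum_(i < (2 * L).+1) \sum_(j < (2 * L).+1)
   (w i * w j * - (eta * #|I|%:R) +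
    (if (i == o) && (j == o) then w L * w L * #|I|%:R else 0)) =
   - (eta * #|I|%:R) + w L * w L * #|I|%:R.
  under eq_bigr do rewrite big_split /=.
  rewrite big_split /=; congr (_ + _).
    under eq_bigr do rewrite -mulr_suml -mulr_sumr sum_cos_weight mulr1.
    by rewrite -mulr_suml sum_cos_weight mul1r.
  rewrite (bigD1 o)//= (bigD1 o)//= !eqxx /= !big1 ?addr0// => i /negPf e.
    by rewrite big1// => j _; rewrite e.
  by rewrite e.
apply/negP; rewrite -ltNge.
have lt' : \sum_n cos (pi * x n) ^+ (2 * L) * cos (pi * y n) ^+ (2 * L) <
    \sum_(n : I) eta.
  apply: ltr_sum => [|n _]; last exact: lt.
  have [n _] := card_gt0P I0.
  by apply/hasP; exists n; rewrite // mem_index_enum.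
apply: (lt_le_trans lt'); rewrite sumr_const -[_ *+ _]mulr_natr.
have s0 : 0 < (2 * L).+1%:R :> R by rewrite ltr0n.
have wL2 : 2 * eta <= w L * w L.
  apply: (@le_trans _ _ (((2 * L).+1%:R)^-1 * ((2 * L).+1%:R)^-1)).
    by rewrite -invfM -[leRHS]mul1r ler_pdivlMr ?mulr_gt0// -expr2.
  by rewrite ler_pM// ?invr_ge0 ?(ltW s0)//; exact: cos_weight_center.
have := ler_wpM2r (ltW Ioo) wL2; lra.
Qed.

(** For [x] above 1/4, [cos (2 * pi * x) <= 0] gives [sin^2 >= 1/2]. Below 1/4 the mean value
    theorem gives [sin (pi * x) = cos c * (pi * x)] with [cos c ^+ 2 >= 1/2], and [pi >= 2]
    suffices. *)
Lemma sqr_sin_ge x : `|x| <= 2^-1 -> x ^+ 2 <= sin (pi * x) ^+ 2.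
Proof.
wlog x0 : x / 0 <= x => [wlg|].
  have [/wlg//|x0] := leP 0 x; rewrite -normrN => xh.
  by have := wlg (- x); rewrite mulrN sinN !sqrrN; apply => //; rewrite oppr_ge0 ltW.
rewrite ger0_norm// => xh.
have p0 : 0 < pi :> R := pi_gt0 R.
have p2 : 2 <= pi :> R := pi_ge2 R.
have cos2 z : cos (2 * z) = 2 * cos z ^+ 2 - 1.
  by rewrite mulr_natl cos_mulr2n mulr_natl.
have [x4|x4] := leP x 4^-1; last first.
  have : cos (2 * (pi * x)) <= 0.
    have -> : 2 * (pi * x) = pi * (2 * x - 2^-1) + pi / 2 by field.
    rewrite cosDpihalf oppr_le0; apply: sin_ge0_pi; apply/andP; split.
      by apply: mulr_ge0; lra.
    nra.
  rewrite cos2 cos2sin2 => h; nra.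
have [->|xn0] := eqVneq x 0; first by rewrite mulr0 sin0.
have xp : 0 < pi * x by rewrite mulr_gt0// lt_neqAle eq_sym xn0.
have [|c] := @MVT R sin cos 0 (pi * x) xp.
  by apply: continuous_subspaceT; exact: continuous_sin.
rewrite in_itv /= => /andP[c0 cx]; rewrite sin0 !subr0 => ->.
have : 0 <= cos (2 * c).
  apply: cos_ge0_pihalf; apply/andP; split; first by nra.
  have : 2 * (pi * x) <= pi / 2 by nra.
  lra.
rewrite cos2 exprMn exprMn => h.
have : 4 * x ^+ 2 <= pi ^+ 2 * x ^+ 2 by rewrite ler_wpM2r ?sqr_ge0//; nra.
have := sqr_ge0 x.
nra.
Qed.

(** The hypothesis says that [sin (pi * x) ^+ 2 < d ^+ 2]. This square has period 1, so [sqr_sin_ge]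
    applies after subtracting the nearest integer. *)
Lemma near_int_of_cos x (d : R) : 0 <= d -> 1 - d ^+ 2 < cos (pi * x) ^+ 2 ->
  exists k : int, `|x - k%:~R| <= d.
Proof.
move=> d0 hx; pose k := Num.floor (x + 2^-1); exists k.
have /andP[k1 k2] := floor_itv (x + 2^-1).
rewrite -/k in k1 k2; rewrite intrD in k2.
have ph : `|x - k%:~R| <= 2^-1 by rewrite ler_norml; lra.
have := sqr_sin_ge _ ph.
have -> : sin (pi * (x - k%:~R)) ^+ 2 = sin (pi * x) ^+ 2.
  rewrite mulrBr sinB; suff [-> e] : sin (pi * k%:~R) = 0 :> R /\ cos (pi * k%:~R) ^+ 2 = 1 :> R.
    by rewrite mulr0 subr0 exprMn e mulr1.
  suff s0 : sin (pi * k%:~R) = 0 :> R by rewrite cos2sin2 s0 expr0n subr0.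
  have sn (n : nat) : sin (pi * n%:R) = 0 :> R.
    elim: n => [|n IH]; first by rewrite mulr0 sin0.
    by rewrite -natr1 mulrDr mulr1 sinDpi IH oppr0.
  case: k {k1 k2 ph} => n; first exact: sn.
  by rewrite NegzE mulrNz mulrN sinN sn oppr0.
rewrite sin2cos2 => h.
have : `|x - k%:~R| ^+ 2 <= d ^+ 2 by rewrite real_normK ?num_real//; lra.
by rewrite ler_sqr ?nnegrE.
Qed.

Lemma dist_int_le x (k : int) (d : R) : `|x - k%:~R| <= d -> dist_int x <= d.
Proof.
apply: le_trans; apply: ge_inf; last by exists k.
by exists 0 => _ [j _ <-].
Qed.

End detection.

(** * Growth of polynomials *)

Section polynomial_growth.
Context {R : realType}.

Lemma horner_asymp (q : {poly R}) : q != 0 ->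
  exists2 X0, 1 <= X0 & forall x, X0 <= x ->
    `|lead_coef q| / 2 * x ^+ (size q).-1 <= `|q.[x]| <=
    2 * `|lead_coef q| * x ^+ (size q).-1.
Proof.
move=> q0; set e := (size q).-1; set a := `|lead_coef q|.
have a0 : 0 < a by rewrite normr_gt0 lead_coef_eq0.
have sq : size q = e.+1 by rewrite prednK// lt0n size_poly_eq0.
pose S := \sum_(i < e) `|q`_i|.
have S0 : 0 <= S by apply: sumr_ge0.
(* For [x >= 1] the lower-order terms total at most [S * x ^+ e.-1] when [e > 0]; beyond [2 * S / a]
   this is at most half of the leading term. *)
exists (1 + 2 * S / a); first by rewrite lerDl divr_ge0 ?mulr_ge0// ltW.
move=> x Xx.
have x1 : 1 <= x by apply: le_trans Xx; rewrite lerDl divr_ge0 ?mulr_ge0// ltW.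
have x0 : 0 < x by exact: lt_le_trans x1.
have tail : `|q.[x] - lead_coef q * x ^+ e| <= a / 2 * x ^+ e.
  rewrite horner_coef sq big_ord_recr /= /lead_coef sq /= addrK.
  have [e0|e0] := posnP e.
    by rewrite big1 ?normr0 ?mulr_ge0 ?exprn_ge0 ?divr_ge0 1?ltW// => -[i]; rewrite e0.
  apply: (@le_trans _ _ (S * x ^+ e.-1)).
    rewrite mulr_suml; apply: (le_trans (ler_norm_sum _ _ _)); apply: ler_sum => i _.
    rewrite normrM (ger0_norm (exprn_ge0 _ (ltW x0))) ler_wpM2l// ler_weXn2l//.
    by rewrite -ltnS prednK.
  rewrite -{2}(prednK e0) exprS mulrA ler_wpM2r ?exprn_ge0 ?(ltW x0)//.
  have : 2 * S / a * a <= x * a by rewrite ler_pM2r//; lra.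
  by rewrite divfK ?gt_eqF//; lra.
have ax : `|lead_coef q * x ^+ e| = a * x ^+ e.
  by rewrite normrM (ger0_norm (exprn_ge0 _ (ltW x0))).
have h1 := ler_normB (q.[x]) (q.[x] - lead_coef q * x ^+ e).
have h2 := ler_normD (q.[x] - lead_coef q * x ^+ e) (lead_coef q * x ^+ e).
rewrite subrK in h2.
rewrite opprB addrC subrK in h1.
have ae : 0 <= a * x ^+ e by rewrite mulr_ge0 ?exprn_ge0// ltW.
by apply/andP; split; lra.
Qed.

(* If [l] vanishes the first term is alone; otherwise [N - x] is so much larger
   than [x] that the second term dominates. *)
Lemma two_point_bounds (q : R -> R) (e : nat) (c C X0 M N L k l : R) :
  0 < c -> c <= C -> (0 < e)%N ->
  (forall x, X0 <= x -> c * x ^+ e <= `|q x| <= C * x ^+ e) ->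
  0 < X0 -> X0 <= M -> 4 * M <= N -> 8 * L * M * C <= c * N -> `|k| <= L ->
  (l = 0 /\ 1 <= `|k|) \/ 1 <= `|l| ->
  exists2 gam, c / 2 * M ^+ e <= gam & forall x, M <= x <= 2 * M ->
    gam <= `|k * q x + l * q (N - x)| <= (2 ^+ e * C * 2 / c + 1) * gam.
Proof.
move=> c0 cC e0 qb X00 XM MN LN kL kl.
have C0 : 0 < C by exact: lt_le_trans cC.
have M0 : 0 < M by exact: lt_le_trans XM.
have Me : 0 < M ^+ e by exact: exprn_gt0.
case: kl => [[-> k1]|l1].
  exists (`|k| * c * M ^+ e).
    by apply: ler_wpM2r; [exact: ltW|nra].
  move=> x /andP[x1 x2]; rewrite mul0r addr0 normrM.
  have /andP[q1 q2] := qb x (le_trans XM x1).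
  apply/andP; split.
    rewrite -mulrA ler_wpM2l//; apply: le_trans q1.
    by rewrite ler_wpM2l ?(ltW c0)// lerXn2r ?nnegrE ?(ltW M0)// (le_trans (ltW M0)).
  apply: (@le_trans _ _ (`|k| * (C * (2 * M) ^+ e))).
    rewrite ler_wpM2l//; apply: (le_trans q2).
    rewrite ler_wpM2l ?(ltW C0)// lerXn2r ?nnegrE ?mulr_ge0 ?(ltW M0)//.
    by rewrite (le_trans (ltW M0)).
  have -> : `|k| * (C * (2 * M) ^+ e) = (2 ^+ e * C / c) * (`|k| * c * M ^+ e).
    by rewrite exprMn; field; rewrite gt_eqF.
  apply: ler_wpM2r; first by rewrite !mulr_ge0// ltW.
  have : 0 <= 2 ^+ e * C / c by rewrite divr_ge0 ?mulr_ge0 ?exprn_ge0// ltW.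
  by rewrite -[2 ^+ e * C * 2 / c]mulrA [2 / c]mulrC mulrA; lra.
have N0 : 0 < N / 2 by lra.
have Ne : 0 < (N / 2) ^+ e by exact: exprn_gt0.
have L0 : 0 <= L by exact: le_trans kL.
(* The ratio of [N / 2] to [2 * M] is at least 1, so its [e]-th power is at least the ratio itself.
   A hypothesis linear in [N] therefore serves every degree [e >= 1]. *)
have dom : L * C * (2 * M) ^+ e <= c / 2 * (N / 2) ^+ e.
  have r1 : 1 <= N / (4 * M) by rewrite ler_pdivlMr ?mulr_gt0// mul1r.
  have -> : (N / 2) ^+ e = (N / (4 * M)) ^+ e * (2 * M) ^+ e.
    by rewrite -exprMn; congr (_ ^+ e); field; rewrite gt_eqF.
  rewrite mulrA ler_wpM2r ?exprn_ge0 ?mulr_ge0 ?(ltW M0)//.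
  apply: (@le_trans _ _ (c / 2 * (N / (4 * M)))); last first.
    rewrite ler_wpM2l ?divr_ge0 ?(ltW c0)//.
    by rewrite -[leLHS]expr1 ler_weXn2l.
  have -> : c / 2 * (N / (4 * M)) = c * N / (8 * M) by field; rewrite gt_eqF.
  by rewrite ler_pdivlMr ?mulr_gt0//; lra.
(* Half of the lower bound for the term in [q (N - x)]; the other half absorbs the term in [q x]. *)
exists (`|l| * (c / 2) * (N / 2) ^+ e).
  apply: ler_pM; rewrite ?divr_ge0 ?(ltW c0) ?(ltW Me)//.
    by rewrite ler_peMl// divr_ge0// ltW.
  by rewrite lerXn2r ?nnegrE ?(ltW M0) ?(ltW N0)//; lra.
move=> x /andP[x1 x2].
have /andP[_ q2] := qb x (le_trans XM x1).
have Nx : N / 2 <= N - x by lra.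
have XN : X0 <= N - x by lra.
have /andP[r1 r2] := qb (N - x) XN.
have x0 : 0 <= x by exact: le_trans (ltW M0) x1.
have kq : `|k * q x| <= L * C * (2 * M) ^+ e.
  rewrite normrM -mulrA ler_pM//; apply: (le_trans q2).
  by rewrite ler_wpM2l ?(ltW C0)// lerXn2r ?nnegrE ?mulr_ge0 ?(ltW M0).
have lq1 : `|l| * c * (N / 2) ^+ e <= `|l * q (N - x)|.
  rewrite normrM -mulrA ler_wpM2l//; apply: le_trans r1.
  by rewrite ler_wpM2l ?(ltW c0)// lerXn2r ?nnegrE ?(ltW N0)//; lra.
have lq2 : `|l * q (N - x)| <= `|l| * (2 ^+ e * C) * (N / 2) ^+ e.
  rewrite normrM -mulrA ler_wpM2l//; apply: (le_trans r2).
  have -> : 2 ^+ e * C * (N / 2) ^+ e = C * (2 * (N / 2)) ^+ e 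
    by rewrite [in RHS]exprMn mulrA [C * _]mulrC.
  by rewrite ler_wpM2l ?(ltW C0)// lerXn2r ?nnegrE; lra.
have dom' : c / 2 * (N / 2) ^+ e <= `|l| * (c / 2) * (N / 2) ^+ e.
  by rewrite ler_wpM2r ?(ltW Ne)// ler_peMl// divr_ge0// ltW.
have h1 := ler_normB (k * q x + l * q (N - x)) (k * q x).
rewrite addrC addKr in h1.
have h2 := ler_normD (k * q x) (l * q (N - x)).
apply/andP; split; first by lra.
have -> : (2 ^+ e * C * 2 / c + 1) * (`|l| * (c / 2) * (N / 2) ^+ e) =
   `|l| * (2 ^+ e * C) * (N / 2) ^+ e + `|l| * (c / 2) * (N / 2) ^+ e.
  by field; rewrite gt_eqF.
by lra.
Qed.

(** Mean value theorem: once on [p] for first differences; for second differences on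
    [p(x + u) - p(x)] and then on the derivative of [p]. All intermediate points stay in [[M, 2M]],
    and the extra factor [u >= 1] is dropped. *)
Lemma poly_difference_bounds (p : {poly R}) (M : nat) (g g1 g2 : R) :
  (forall x, M%:R <= x <= 2 * M%:R -> g1 <= `|p^`().[x]| <= g2) ->
  (forall x, M%:R <= x <= 2 * M%:R -> g <= `|p^`()^`().[x]|) -> 0 <= g ->
  [/\ forall a b, (a < b < M)%N ->
        g1 * (b%:R - a%:R) <= `|p.[(M + b)%:R] - p.[(M + a)%:R]|,
      forall a b, (a < b < M)%N ->
        `|p.[(M + b)%:R] - p.[(M + a)%:R]| <= g2 * (b%:R - a%:R) &
      forall a b u, (a < b)%N -> (0 < u)%N -> (b + u < M)%N ->
        g * (b%:R - a%:R) <= `|p.[(M + (b + u))%:R] - p.[(M + b)%:R] -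
          (p.[(M + (a + u))%:R] - p.[(M + a)%:R])|].
Proof.
move=> d1 d2 g0.
have first a b : (a < b < M)%N -> exists2 c, M%:R <= c <= 2 * M%:R &
    `|p.[(M + b)%:R] - p.[(M + a)%:R]| = `|p^`().[c]| * (b%:R - a%:R).
  move=> /andP[ab bM].
  have [|c] := @poly_mvt R (M + a)%:R (M + b)%:R p.
    by rewrite ltr_nat ltn_add2l.
  rewrite in_itv /= => /andP[c1 c2] ->.
  exists c; last first.
    rewrite normrM; congr (_ * _); rewrite !natrD opprD addrACA subrr add0r.
    by rewrite ger0_norm// subr_ge0 ler_nat ltnW.
  apply/andP; split.
    by apply: ltW; apply: le_lt_trans c1; rewrite ler_nat leq_addr.
  by apply: ltW; apply: (lt_le_trans c2); rewrite -natrM ler_nat; lia.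
split.
- move=> a b ab; have [c cM ->] := first a b ab.
  have /andP[h _] := d1 _ cM; move/andP: ab => [ab' _].
  by rewrite ler_wpM2r// subr_ge0 ler_nat ltnW.
- move=> a b ab; have [c cM ->] := first a b ab.
  have /andP[_ h] := d1 _ cM; move/andP: ab => [ab' _].
  by rewrite ler_wpM2r// subr_ge0 ler_nat ltnW.
- move=> a b u ab u0 buM.
  pose D := p \Po ('X + u%:R%:P) - p.
  have DE x : D.[x] = p.[x + u%:R] - p.[x].
    by rewrite /D hornerD hornerN horner_comp hornerD hornerX hornerC.
  have -> : p.[(M + (b + u))%:R] - p.[(M + b)%:R] -
      (p.[(M + (a + u))%:R] - p.[(M + a)%:R]) = D.[(M + b)%:R] - D.[(M + a)%:R].
    by rewrite !DE !addnA !natrD.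
  have [|c] := @poly_mvt R (M + a)%:R (M + b)%:R D.
    by rewrite ltr_nat ltn_add2l.
  rewrite in_itv /= => /andP[c1 c2] ->.
  have -> : D^`().[c] = p^`().[c + u%:R] - p^`().[c].
    rewrite /D derivB deriv_comp derivD derivX derivC addr0 mulr1.
    by rewrite hornerD hornerN horner_comp hornerD hornerX hornerC.
  have [|d] := @poly_mvt R c (c + u%:R) p^`().
    by rewrite ltrDl ltr0n.
  rewrite in_itv /= => /andP[d1' d2'] ->.
  rewrite [c + _]addrC addrK !normrM.
  have -> : `|(M + b)%:R - (M + a)%:R| = b%:R - a%:R :> R.
    rewrite !natrD opprD addrACA subrr add0r.
    by rewrite ger0_norm// subr_ge0 ler_nat ltnW.
  rewrite ler_wpM2r ?subr_ge0 ?ler_nat ?(ltnW ab)//.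
  rewrite -[g]mulr1 ler_pM//; last by rewrite normr_nat ler1n.
  apply: d2; apply/andP; split.
    apply: ltW; apply: le_lt_trans d1'; apply: ltW.
    by apply: le_lt_trans c1; rewrite ler_nat leq_addr.
  apply: ltW; apply: (lt_le_trans d2'); apply: (@le_trans _ _ ((M + b)%:R + u%:R)).
    by rewrite lerD2r ltW.
  by rewrite -natrD -natrM ler_nat; lia.
Qed.

(** [two_point_bounds] is applied to the first two derivatives of [b], of degrees at least 2 and 1,
    whence the powers [M ^+ 2] and [M]. The size of the first derivative varies with [k], [l] and
    [N]; hence one [g1], with a comparable upper bound [C * g1], instead of a fixed power of [M]. *)
Lemma two_point_phase_bounds (b : {poly R}) : (3 < size b)%N ->
  exists c C A X0 : R, [/\ 0 < c, 0 < C, 0 < A, 1 <= X0 &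
    forall (M N : nat) (L k l : R), X0 <= M%:R -> (4 * M <= N)%N ->
      A * L * M%:R <= N%:R -> `|k| <= L ->
      (l = 0 /\ 1 <= `|k|) \/ 1 <= `|l| ->
      let phi n := k * b.[(M + n)%:R] + l * b.[N%:R - (M + n)%:R] in
      exists2 g1, c * M%:R ^+ 2 <= g1 &
      [/\ forall i j, (i < j < M)%N ->
            g1 * (j%:R - i%:R) <= `|phi j - phi i|,
          forall i j, (i < j < M)%N ->
            `|phi j - phi i| <= C * g1 * (j%:R - i%:R) &
          forall i j u, (i < j)%N -> (0 < u)%N -> (j + u < M)%N ->
            c * M%:R * (j%:R - i%:R) <=
            `|phi (j + u)%N - phi j - (phi (i + u)%N - phi i)|]].
Proof.
move=> sb.
have s1 : size b^`() = (size b).-1 := size_deriv b.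
have s2 : size b^`()^`() = (size b).-2 by rewrite size_deriv s1.
have b1 : b^`() != 0 by rewrite -size_poly_gt0 s1; lia.
have b2 : b^`()^`() != 0 by rewrite -size_poly_gt0 s2; lia.
have [X1 X11 q1] := horner_asymp _ b1; have [X2 X21 q2] := horner_asymp _ b2.
set a1 := `|lead_coef b^`()| in q1; set a2 := `|lead_coef b^`()^`()| in q2.
have a10 : 0 < a1 by rewrite normr_gt0 lead_coef_eq0.
have a20 : 0 < a2 by rewrite normr_gt0 lead_coef_eq0.
rewrite s1 in q1; rewrite s2 in q2.
set e1 := (size b).-1.-1 in q1; set e2 := (size b).-2.-1 in q2.
have e1_gt1 : (1 < e1)%N by rewrite /e1; lia.
have e2_gt0 : (0 < e2)%N by rewrite /e2; lia.
pose c := Num.min (a1 / 2 / 2) (a2 / 2 / 2).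
(* [horner_asymp] gives the constants [a / 2] and [2 * a], so the condition
   [8 * L * M * (2 * a) <= a / 2 * N] reads [32 * L * M <= N]. *)
exists c, (2 ^+ e1 * (2 * a1) * 2 / (a1 / 2) + 1), 32, (Num.max X1 X2); split.
- by rewrite lt_min; apply/andP; split; lra.
- by rewrite addr_gt0// divr_gt0 ?mulr_gt0 ?exprn_gt0//; lra.
- by [].
- by rewrite le_max X11.
move=> M N L k l; rewrite ge_max => /andP[XM1 XM2] MN ALM kL kl phi.
have MN' : 4 * M%:R <= N%:R :> R by rewrite -natrM ler_nat.
have M1 : 1 <= M%:R :> R by exact: le_trans XM1.
pose p := k *: b + l *: (b \Po (N%:R%:P - 'X)).
have phiE n : phi n = p.[(M + n)%:R].
  by rewrite /p hornerD !hornerZ horner_comp hornerD hornerN hornerX hornerC.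
have pd x : p^`().[x] = k * b^`().[x] + - l * b^`().[N%:R - x].
  rewrite /p derivD !derivZ deriv_comp derivB derivX derivC sub0r mulrN1 scalerN.
  by rewrite hornerD hornerN !hornerZ horner_comp hornerD hornerN hornerX hornerC mulNr.
have pdd x : p^`()^`().[x] = k * b^`()^`().[x] + l * b^`()^`().[N%:R - x].
  rewrite /p derivD !derivZ deriv_comp derivB derivX derivC sub0r mulrN1 scalerN.
  rewrite derivD derivN !derivZ deriv_comp derivB derivX derivC sub0r mulrN1 scalerN.
  by rewrite opprK hornerD !hornerZ horner_comp hornerD hornerN hornerX hornerC.
have klN : (- l = 0 /\ 1 <= `|k|) \/ 1 <= `|- l|.
  by case: kl => [[-> k1]|l1]; [left; rewrite oppr0|right; rewrite normrN].
have dom (a : R) : 0 < a -> 8 * L * M%:R * (2 * a) <= a / 2 * N%:R.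
  by move=> a0; have := ler_wpM2l (ltW a0) ALM; lra.
have cst (a : R) : 0 < a -> 0 < a / 2 /\ a / 2 <= 2 * a by move=> a0; split; lra.
have [c1 C1] := cst a1 a10; have [c2 C2] := cst a2 a20.
have [g1 g1M g1P] := @two_point_bounds (fun x => b^`().[x]) e1 _ _ X1
  M%:R N%:R L k (- l) c1 C1 (ltnW e1_gt1) q1 (lt_le_trans ltr01 X11) XM1 MN'
  (dom _ a10) kL klN.
have [g gM gP] := @two_point_bounds (fun x => b^`()^`().[x]) e2 _ _ X2
  M%:R N%:R L k l c2 C2 e2_gt0 q2 (lt_le_trans ltr01 X21) XM2 MN'
  (dom _ a20) kL kl.
exists g1.
  apply: le_trans g1M; apply: ler_pM.
  - by rewrite le_min; apply/andP; split; lra.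
  - by rewrite exprn_ge0.
  - by rewrite ge_min lexx.
  - by rewrite ler_weXn2l.
have cM : c * M%:R <= g.
  apply: le_trans gM; apply: ler_pM => //.
  - by rewrite le_min; apply/andP; split; lra.
  - by rewrite ge_min lexx orbT.
  - by rewrite -[leLHS]expr1 ler_weXn2l.
have [|x xM||D1 D2 D3] := @poly_difference_bounds p M (c * M%:R) g1
    ((2 ^+ e1 * (2 * a1) * 2 / (a1 / 2) + 1) * g1).
- by move=> x xM; rewrite pd; exact: g1P.
- by rewrite pdd; apply: (le_trans cM); have /andP[] := gP x xM.
- by rewrite mulr_ge0// le_min; apply/andP; split; lra.
by split=> [i j|i j|i j u]; rewrite !phiE; [exact: D1|exact: D2|exact: D3].
Qed.

End polynomial_growth.

(** * Mean values of exponential sums *)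

Section mean_values.
Context {R : realType}.
Let mu := @lebesgue_measure R.
Implicit Types T w p : R.

Let wave w p : R -> R := fun s => cos (w * s + p).

Lemma continuous_wave w p : continuous (wave w p).
Proof.
move=> s; apply: (@continuous_comp _ _ _ (fun s => w * s + p) cos).
  by apply: cvgD; [apply: cvgM; [exact: cvg_cst|exact: cvg_id]|exact: cvg_cst].
exact: continuous_cos.
Qed.

Lemma integrable_wave w p T : mu.-integrable `[(- T)%R, T] (EFin \o wave w p).
Proof.
apply: continuous_compact_integrable; first exact: segment_compact.
by apply: continuous_subspaceT; exact: continuous_wave.
Qed.

Lemma integral_wave_le_length w p T : 0 <= T ->
  (\int[mu]_(s in `[(- T)%R, T]) (wave w p s)%:E <= (2 * T)%:E)%E.
Proof.
move=> T0; apply: (@le_trans _ _ (\int[mu]_(s in `[(- T)%R, T]) (cst 1%:E s))%E).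
  apply: le_integral => //; first exact: integrable_wave.
    apply: continuous_compact_integrable; first exact: segment_compact.
    by apply: continuous_subspaceT => s; exact: cvg_cst.
  by move=> s _; rewrite lee_fin cos_le1.
rewrite integral_cst//= mul1e lebesgue_measure_itv /=.
case: ifPn => _; last by rewrite lee_fin mulr_ge0.
by rewrite -EFinB lee_fin opprK; lra.
Qed.

Lemma integral_wave_le_freq w p T : 0 < T -> w != 0 ->
  (\int[mu]_(s in `[(- T)%R, T]) (wave w p s)%:E <= (2 / `|w|)%:E)%E.
Proof.
move=> T0 w0; pose F s := sin (w * s + p) / w.
have dF s : is_derive s (1 : R) F (wave w p s).
  have d1 : is_derive s (1 : R) (fun s => w * s + p) w.
    by apply: is_derive_eq; rewrite addr0 /GRing.scale /= mulr1.
  have d2 := @is_derive1_comp R sin (fun s => w * s + p) s _ _ (is_derive_sin _) d1.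
  have -> : F = w^-1 \*: (sin \o (fun s => w * s + p)).
    by apply/funext => t; rewrite /F /= mulrC.
  apply: is_derive_eq; rewrite /wave /GRing.scale /=.
  by rewrite mulrCA mulVf// mulr1.
have cF : continuous F.
  move=> s; apply: differentiable_continuous; apply/derivable1_diffP.
  exact: (@ex_derive _ _ _ _ _ _ _ (dF s)).
have lt : - T < T by lra.
rewrite (@continuous_FTC2 _ _ F)//.
- have sF (s : R) : `|F s| <= `|w|^-1.
    by rewrite normrM normfV ler_piMl// sin_max.
  have h1 := sF T; have h2 := sF (- T).
  rewrite -EFinB lee_fin; apply: (le_trans (ler_norm _)).
  by apply: (le_trans (ler_normB _ _)); lra.
- by apply: continuous_subspaceT; exact: continuous_wave.
- split.
  + by move=> s _; exact: (@ex_derive _ _ _ _ _ _ _ (dF s)).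
  + by apply: cvg_at_right_filter; exact: cF.
  + by apply: cvg_at_left_filter; exact: cF.
- by move=> s _; rewrite derive1E; exact: (@derive_val _ _ _ _ _ _ _ (dF s)).
Qed.

(** Frequencies up to [W] get the trivial bound [2 * T]; above [W], the sine antiderivative gives at
    most [1 / (pi * |Delta|) <= 1 / W]. *)
Lemma integral_phase_le (Delta c T W : R) : 0 < T -> 0 < W ->
  (\int[mu]_(s in `[(- T)%R, T]) (cos (2 * pi * (Delta * s + c)))%:E <=
     ((if `|Delta| <= W then 2 * T else 0) + W^-1)%:E)%E.
Proof.
move=> T0 W0.
have -> : (fun s => (cos (2 * pi * (Delta * s + c)))%:E) =
    (fun s => (wave (2 * pi * Delta) (2 * pi * c) s)%:E).
  by apply/funext => s; rewrite /wave; congr (cos _)%:E; ring.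
case: ifPn => [_|].
  apply: (le_trans (integral_wave_le_length _ _ _ (ltW T0))).
  by rewrite lee_fin lerDl invr_ge0 ltW.
rewrite -ltNge => WD; have D0 : 0 < `|Delta| by exact: lt_trans WD.
have Dn : Delta != 0 by rewrite -normr_gt0.
have p0 : 0 < pi :> R := pi_gt0 R.
apply: (le_trans (integral_wave_le_freq _ _ _ T0 _)).
  by rewrite !mulf_neq0// gt_eqF.
rewrite lee_fin add0r !normrM (ger0_norm (ltW p0)) ger0_norm//.
have -> : 2 / (2 * pi * `|Delta|) = (pi * `|Delta|)^-1.
  by rewrite -mulrA invfM mulrA divff ?mul1r ?pnatr_eq0.

rewrite lef_pV2 ?posrE ?mulr_gt0//; apply: (le_trans (ltW WD)).
by rewrite ler_peMl ?(ltW D0)//; have := pi_ge2 R; lra.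
Qed.

Lemma integral_sum_phases_le (I : finType) (P : pred I) (Delta c : I -> R)
    (T W : R) : 0 < T -> 0 < W ->
  (\int[mu]_(s in `[(- T)%R, T])
      (\sum_(q | P q) cos (2 * pi * (Delta q * s + c q)))%:E <=
   (2 * T * #|[pred q | P q && (`|Delta q| <= W)]|%:R + #|P|%:R / W)%:E)%E.
Proof.
move=> T0 W0.
have -> : (2 * T * #|[pred q | P q && (`|Delta q| <= W)]|%:R + #|P|%:R / W)%:E =
   (\sum_(q | P q) ((if `|Delta q| <= W then 2 * T else 0) + W^-1)%:E)%E.
  rewrite sumEFin big_split /= -big_mkcondr /=; congr (_ + _)%:E.
    by rewrite mulr_natr -sumr_const; apply: eq_bigl => q; rewrite inE.
  by rewrite mulr_natl -sumr_const; apply: eq_bigl.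
under eq_integral do rewrite -sumEFin.
rewrite integral_sum//.
  by apply: lee_sum => q _; exact: integral_phase_le.
move=> q; have := integrable_wave (2 * pi * Delta q) (2 * pi * c q) T.
congr (mu.-integrable _ _); apply/funext => s; rewrite /wave /=.
by congr (cos _)%:E; ring.
Qed.

(** Markov's inequality for [f], whose integral is controlled by the trigonometric majorant. It is
    meant for [f] the fourth power of a cosine sum. *)
Lemma markov_phases (I : finType) (P : pred I) (Delta c : I -> R) (f : R -> R)
    (T W C y : R) : 0 < T -> 0 < W -> 0 < y -> 0 <= C ->
  (forall s, 0 <= f s) ->
  (forall s, f s <= C * \sum_(q | P q) cos (2 * pi * (Delta q * s + c q))) ->
  measurable_fun setT f ->
  (mu (`[(- T)%R, T] `&` [set s | (y <= f s)%R]) <=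
   (C * (2 * T * #|[pred q | P q && (`|Delta q| <= W)]|%:R + #|P|%:R / W) / y)%:E)%E.
Proof.
move=> T0 W0 y0 C0 f0 fP mf.
have cS : continuous (fun s => \sum_(q | P q) cos (2 * pi * (Delta q * s + c q))).
  apply: continuous_big => [|q _]; first exact: add_continuous.
  have -> : (fun s => cos (2 * pi * (Delta q * s + c q))) =
      wave (2 * pi * Delta q) (2 * pi * c q).
    by apply/funext => t; rewrite /wave; congr cos; ring.
  exact: continuous_wave.
have iS : mu.-integrable `[(- T)%R, T]
    (EFin \o (fun s => \sum_(q | P q) cos (2 * pi * (Delta q * s + c q)))).
  by apply: continuous_compact_integrable; [exact: segment_compact|exact: continuous_subspaceT].
have mfD : measurable_fun `[(- T)%R, T]%classic f by exact: measurable_funTS.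
have /measurable_EFinP mSE := mfD.
have := @le_integral_abse _ _ _ mu `[(- T)%R, T]%classic (measurable_itv _)
   (fun s => (f s)%:E) y mSE y0.
have -> : [set x | (y%:E <= `|(f x)%:E|)%E] = [set s | y <= f s].
  by apply/seteqP; split=> s /=; rewrite lee_fin ger0_norm.
move=> h; rewrite EFinM lee_pdivlMr// muleC; apply: (le_trans h).
rewrite EFinM; apply: (@le_trans _ _ (C%:E * \int[mu]_(s in `[(- T)%R, T])
    (\sum_(q | P q) cos (2 * pi * (Delta q * s + c q)))%:E)%E).
  rewrite -integralZl//; apply: ge0_le_integral => //.
  - exact: measurableT_comp.
  - by apply: emeasurable_funM => //; exact: (measurable_int _ iS).
  - by move=> s _; rewrite /= ger0_norm// -EFinM lee_fin.
by apply: lee_wpmul2l; [rewrite lee_fin|exact: integral_sum_phases_le].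
Qed.

Lemma measurable_cos_affine (d : measure_display) (X : measurableType d)
   (f : X -> R) : measurable_fun setT f -> measurable_fun setT (fun x => cos (f x)).
Proof.
move=> mf; apply: (@measurableT_comp _ _ _ _ _ _ cos) => //.
by apply: continuous_measurable_fun; exact: continuous_cos.
Qed.

(** Fourth moment with [M = kap^3], blocks of length [kap] and [W = kap^4]. Near quadruples number
    [O(kap^6)]; all [kap^10] block quadruples, divided by [W], also give [kap^6]. The factor [kap^2]
    for the number of blocks makes the moment [O(kap^8)], against the trivial [M^4 = kap^12]. *)
Lemma large_values (kap : nat) (phi ph : nat -> R) (c C g1 T y : R) :
  (0 < kap)%N -> 0 < c -> 0 < C -> 2 * kap%:R ^+ 4 <= g1 -> 0 < T -> 0 < y ->
  let M := (kap ^ 3)%N in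
  (forall i j, (i < j < M)%N -> g1 * (j%:R - i%:R) <= `|phi j - phi i|) ->
  (forall i j, (i < j < M)%N -> `|phi j - phi i| <= C * g1 * (j%:R - i%:R)) ->
  (forall i j u, (i < j)%N -> (0 < u)%N -> (j + u < M)%N ->
     c * M%:R * (j%:R - i%:R) <=
     `|phi (j + u)%N - phi j - (phi (i + u)%N - phi i)|) ->
  (mu (`[(- T)%R, T] `&`
       [set s | (y <= `|\sum_(n < M) cos (2 * pi * (phi n * s + ph n))|)%R ]) <=
   ((2 * T * (2 + 4 * (1 + C) * (2 / c + 1)) + 1) * kap%:R ^+ 8 / y ^+ 4)%:E)%E.
Proof.
move=> kap0 c0 C0 g1_ge T0 y0 M H1 H2 H3.
set K : R := kap%:R; have K1 : 1 <= K by rewrite /K ler1n.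
have K0 : 0 < K by lra.
have KM : M%:R = K ^+ 3 :> R by rewrite /M natrX.
have W0 : 0 < K ^+ 4 by exact: exprn_gt0.
have g10 : 0 < g1 by apply: lt_le_trans g1_ge; lra.
have cM0 : 0 < c * M%:R by rewrite KM mulr_gt0// exprn_gt0.
have Cg0 : 0 <= C * g1 by rewrite mulr_ge0// ltW.
have MBG : M = (kap ^ 2 * kap)%N by rewrite /M expnSr.
pose S s := \sum_(n < M) cos (2 * pi * (phi n * s + ph n)).
pose ga (q : quad M) := quad_gap M phi q.
pose gc (q : quad M) := quad_gap M ph q.
have sub4 : [set s | y <= `|S s|] `<=` [set s | y ^+ 4 <= S s ^+ 4].
  move=> s /= h; rewrite (_ : S s ^+ 4 = `|S s| ^+ 4).
    by rewrite lerXn2r ?nnegrE ?(ltW y0).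
  by rewrite -normrX ger0_norm// (_ : 4 = 2 * 2)%N// exprM sqr_ge0.
have mS : measurable_fun setT S.
  apply: measurable_sum => n; apply: measurable_cos_affine.
  apply: measurable_funM; first exact: measurable_cst.
  apply: measurable_funD; last exact: measurable_cst.
  by apply: measurable_funM; [exact: measurable_cst|exact: measurable_id].
have mS4 : measurable_fun setT (fun s => S s ^+ 4) by exact: measurable_funX.
have S4 s : 0 <= S s ^+ 4 by rewrite (_ : 4 = 2 * 2)%N// exprM sqr_ge0.
have S4le s : S s ^+ 4 <= (kap ^ 2)%:R * \sum_(q : quad M | same_block M kap q.1)
     cos (2 * pi * (ga q * s + gc q)).
  apply: (le_trans (@quartic_sum_cos_le R M kap (kap ^ 2) kap0 MBG
      (fun n => 2 * pi * (phi n * s + ph n)))).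
  rewrite ler_wpM2l// ler_sum// => q _.
  rewrite /ga /gc /quad_gap le_eqVlt; apply/orP; left; apply/eqP.
  by congr cos; ring.
apply: (@le_trans _ _ (mu (`[(- T)%R, T] `&` [set s | y ^+ 4 <= S s ^+ 4]))).
  apply: le_measure; rewrite ?inE.
  - apply: measurableI => //; rewrite -[X in measurable X]setTI.
    apply: (@measurable_fun_le _ _ _ setT (cst y) (fun s => `|S s|)) => //.
    exact: measurableT_comp.
  - apply: measurableI => //; rewrite -[X in measurable X]setTI.
    by apply: (@measurable_fun_le _ _ _ setT (cst (y ^+ 4)) (fun s => S s ^+ 4)).
  - exact: setIS.
have y40 : 0 < y ^+ 4 by exact: exprn_gt0.
apply: (le_trans (@markov_phases (quad M) (fun q => same_block M kap q.1) ga gc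
   (fun s => S s ^+ 4) T (K ^+ 4) (kap ^ 2)%:R (y ^+ 4) T0 W0 y40 (ler0n _ _)
   S4 S4le mS4)).
rewrite lee_fin ler_pM2r ?invr_gt0//.
have cardP : #|[pred q : quad M | same_block M kap q.1]|%:R <= K ^+ 10.
  have -> : #|[pred q : quad M | same_block M kap q.1]| =
      (#|[set p | same_block M kap p]%SET| * #|finset.setTfor ('I_M * 'I_M)|)%N.
    by rewrite -cardsX; apply: eq_card => q; rewrite !inE andbT.
  rewrite natrM cardsT card_prod card_ord natrM KM.
  have h := @card_same_block R M kap kap0; rewrite KM in h.
  have -> : K ^+ 10 = K ^+ 3 * K * (K ^+ 3 * K ^+ 3) by ring.
  by apply: ler_wpM2r => //; rewrite mulr_ge0 ?exprn_ge0// ltW.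
have cardN : #|[pred q : quad M | same_block M kap q.1 && (`|ga q| <= K ^+ 4)]|%:R
   <= (2 + 4 * (1 + C) * (2 / c + 1)) * K ^+ 6.
  have := @card_near_quads R M kap phi (c * M%:R) g1 (C * g1) (K ^+ 4) cM0 g10
     (ltW W0) kap0 H1 H2 H3 Cg0.
  have -> : #|near_quads M kap phi (K ^+ 4)| =
     #|[pred q : quad M | same_block M kap q.1 && (`|ga q| <= K ^+ 4)]|.
    by apply: eq_card => q; rewrite !inE.
  move=> h; apply: (le_trans h) => {h}.
  (* The three window sizes in [card_near_quads]: the fixed-entry windows are [O(1)], the close
     pairs and the convexity windows [O(K)]. *)
  have w1 : 2 * K ^+ 4 / g1 <= 1 by rewrite ler_pdivrMr// mul1r.
  have w2 : 2 * (K ^+ 4 + C * g1 * K) / g1 + 1 <= 2 * (1 + C) * K.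
    have -> : 2 * (K ^+ 4 + C * g1 * K) / g1 = 2 * K ^+ 4 / g1 + 2 * C * K.
      by field; rewrite gt_eqF.
    lra.
  have w3 : 2 * K ^+ 4 / (c * M%:R) + 1 <= (2 / c + 1) * K.
    rewrite KM (_ : 2 * K ^+ 4 / (c * K ^+ 3) = 2 / c * K); first by lra.
    by field; rewrite !gt_eqF.
  rewrite KM -/K [leRHS]mulrDl; apply: lerD.
    have -> : (K ^+ 3) ^+ 2 = K ^+ 6 by ring.
    by rewrite mulrC ler_wpM2r ?exprn_ge0 ?(ltW K0)//; lra.
  have -> : 4 * (1 + C) * (2 / c + 1) * K ^+ 6 =
     (2 * K) * (K ^+ 3 * (2 * (1 + C) * K)) * ((2 / c + 1) * K) by ring.
  have K3 : 0 <= K ^+ 3 by rewrite exprn_ge0// ltW.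
  apply: ler_pM.
  - rewrite mulr_ge0 ?mulr_ge0 ?(ltW K0)// addr_ge0// divr_ge0 ?(ltW g10)//.
    by rewrite mulr_ge0// addr_ge0 ?(ltW W0)// mulr_ge0 ?(ltW K0).
  - by rewrite -KM addr_ge0// divr_ge0 ?(ltW cM0)// mulr_ge0// ltW.
  - by rewrite !ler_wpM2l// mulr_ge0// ltW.
  - by rewrite -KM.
rewrite natrX -/K.
apply: (@le_trans _ _ (K ^+ 2 * (2 * T * ((2 + 4 * (1 + C) * (2 / c + 1)) * K ^+ 6) + K ^+ 10 / K ^+ 4))).
  rewrite ler_wpM2l ?exprn_ge0 ?(ltW K0)//; apply: lerD.
    by rewrite ler_wpM2l// mulr_ge0// ltW.
  by rewrite ler_wpM2r// invr_ge0 ltW.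
rewrite le_eqVlt; apply/orP; left; apply/eqP.
have K10 : K ^+ 10 / K ^+ 4 = K ^+ 6.
  by rewrite (_ : 10 = 6 + 4)%N// exprD mulfK// gt_eqF.
by rewrite K10; ring.
Qed.

End mean_values.

(** * Exceptional events *)

Section exceptional_events.
Context {R : realType}.

Lemma measure_exists_le (d : measure_display) (X : measurableType d)
    (m : {measure set X -> \bar R}) (I : finType) (F : I -> set X) (B : R) :
  (forall i, measurable (F i)) -> (forall i, m (F i) <= B%:E)%E ->
  (m [set x | exists i, F i x] <= (#|I|%:R * B)%:E)%E.
Proof.
move=> mF mB.
have mU s : measurable (\big[setU/set0]_(i <- s) F i).
  by elim/big_ind : _ => // A1 A2; exact: measurableU.
have seqB (s : seq I) :
    (m (\big[setU/set0]_(i <- s) F i) <= ((size s)%:R * B)%:E)%E.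
  elim: s => [|i s IH]; first by rewrite big_nil measure0 mul0r.
  rewrite big_cons; apply: (le_trans (measureU2 m (mF i) (mU s))).
  by rewrite /= -natr1 mulrDl mul1r addrC EFinD leeD.
rewrite cardE (_ : [set x | exists i, F i x] = \big[setU/set0]_(i <- enum I) F i)//.
rewrite -bigcup_seq; apply/seteqP; split=> [x [i Fi]|x [i _ Fi]]; last by exists i.
by exists i; rewrite //= mem_enum.
Qed.

(* All parameters are powers of [K]: [N] is about [K ^ 112], the first summand
   [n] ranges over [[M, 2 M)] with [M = K ^ 108 = (K ^ 36) ^ 3], blocks have length
   [K ^ 36] and the required precision is [1 / K]. With these choices the
   exceptional set attached to all [N] of size [K ^ 112] has measure
   [O(K ^ -2)]. Taking [n] much smaller than [N] keeps the second derivative of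
   [k b(n) + l b(N - n)] away from zero for all small [k] and [l]. *)
Definition kernel_degree (K : nat) := (8 * K ^ 3)%N.

(** The threshold [eta] of [kernel_detection]. With [L = 8 * K^3] one has [2 * (2 * L + 1)^2 <= 2 *
    17^2 * K^6 = 578 * K^6], which explains 600. *)
Definition sum_bound (K : nat) : R := (600 * K%:R ^+ 6)^-1.

(** The values [u] form an arbitrary sequence, so the same events serve for a line in the family and
    for the whole family. *)
Definition pair_sum (K N i j : nat) (u : nat -> R) : R :=
  \sum_(n < (K ^ 36) ^ 3) cos (2 * pi *
    (((kernel_degree K)%:R - i%:R) * u ((K ^ 36) ^ 3 + n)%N +
     ((kernel_degree K)%:R - j%:R) * u (N - ((K ^ 36) ^ 3 + n))%N)).

Definition bad_index (K : nat) := ('I_(K.+1 ^ 112) *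
  ('I_(2 * kernel_degree K).+1 * 'I_(2 * kernel_degree K).+1))%type.

Definition bad_at (K : nat) (t : bad_index K) (u : nat -> R) : Prop :=
  [&& (K ^ 112 <= t.1)%N, (t.2.1 != kernel_degree K :> nat) ||
    (t.2.2 != kernel_degree K :> nat) &
    sum_bound K * ((K ^ 36) ^ 3)%:R <= `|pair_sum K t.1 t.2.1 t.2.2 u|].

Definition bad (K : nat) (u : nat -> R) : Prop := exists t, bad_at K t u.

Lemma measurable_pair_sum (d : measure_display) (X : measurableType d)
    (u : X -> nat -> R) K N i j : (forall n, measurable_fun setT (u ^~ n)) ->
  measurable_fun setT (fun x => pair_sum K N i j (u x)).
Proof.
move=> mu_; apply: measurable_sum => n; apply: measurable_cos_affine.
apply: measurable_funM; first exact: measurable_cst.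
by apply: measurable_funD; apply: measurable_funM; [exact: measurable_cst|exact: mu_|exact: measurable_cst|exact: mu_].
Qed.

Lemma measurable_bad_at (d : measure_display) (X : measurableType d)
    (u : X -> nat -> R) K (t : bad_index K) :
  (forall n, measurable_fun setT (u ^~ n)) ->
  measurable [set x | bad_at K t (u x)].
Proof.
move=> mu_; rewrite /bad_at.
case: (K ^ 112 <= t.1)%N => /=; last by rewrite (_ : [set x | _] = set0)//; apply/seteqP; split.
case: (_ || _) => /=; last by rewrite (_ : [set x | _] = set0)//; apply/seteqP; split.
rewrite -[X in measurable X]setTI.
apply: (@measurable_fun_le _ _ _ setT (cst _) (fun x => `|pair_sum K t.1 t.2.1 t.2.2 (u x)|)) => //.
by apply: measurableT_comp => //; exact: measurable_pair_sum.
Qed.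

Lemma measurable_bad (d : measure_display) (X : measurableType d)
    (u : X -> nat -> R) K : (forall n, measurable_fun setT (u ^~ n)) ->
  measurable [set x | bad K (u x)].
Proof.
move=> mu_; rewrite (_ : [set x | _] =
    \bigcup_(t in [set: bad_index K]) [set x | bad_at K t (u x)]).
  apply: fin_bigcup_measurable; first exact: finite_finset.
  by move=> t _; exact: measurable_bad_at.
by apply/seteqP; split=> [x [t h]|x [t _ h]]; exists t.
Qed.

(** A Bernoulli-type bound gives [x^(K^3) <= 1 / (1 + K)]. Its eighth power is below
    [1 / (600 * K^6)], since [(1 + K)^2 >= 26^2 = 676]. *)
Lemma kernel_small (K : nat) (x : R) : (25 <= K)%N -> 0 <= x -> x <= 1 - K%:R ^- 2 ->
  x ^+ (kernel_degree K) < sum_bound K.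
Proof.
move=> K25 x0 xK; have K1 : 25 <= K%:R :> R by rewrite ler_nat.
have K0 : 0 < K%:R :> R by lra.
have bern (n : nat) : x ^+ n * (1 + n%:R * K%:R ^- 2) <= 1.
  elim: n => [|n IH]; first by rewrite mul1r mul0r addr0.
  apply: le_trans IH; rewrite exprSr -mulrA ler_wpM2l ?exprn_ge0//.
  set z := K%:R ^- 2 in xK *.
  have z0 : 0 <= z by rewrite invr_ge0 exprn_ge0// ltW.
  have nz : 0 <= n%:R * z * z by rewrite !mulr_ge0.
  have nz' : 0 <= n%:R * z by rewrite mulr_ge0.
  apply: (@le_trans _ _ ((1 - z) * (1 + n.+1%:R * z))); last by rewrite -natr1; nra.
  by rewrite ler_wpM2r// addr_ge0// mulr_ge0.
have h : x ^+ (K ^ 3) * (1 + K%:R) <= 1.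
  have := bern (K ^ 3)%N; rewrite natrX (_ : K%:R ^+ 3 * K%:R ^- 2 = K%:R)//.
  by rewrite exprS mulfK// expf_neq0// gt_eqF.
have y0 : 0 <= x ^+ (K ^ 3) by rewrite exprn_ge0.
have y1 : x ^+ (K ^ 3) <= (1 + K%:R)^-1.
  by rewrite -[(_)^-1]mul1r ler_pdivlMr// addr_gt0.
rewrite /kernel_degree mulnC exprM.
apply: (@le_lt_trans _ _ ((1 + K%:R)^-1 ^+ 8)).
  by rewrite lerXn2r ?nnegrE// invr_ge0 addr_ge0// ltW.
have K6 : 0 < K%:R ^+ 6 :> R by rewrite exprn_gt0.
have K8 : 0 < (1 + K%:R) ^+ 8 :> R by rewrite exprn_gt0// addr_gt0.
have c0 : 0 < 600 :> R by rewrite ltr0n.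
rewrite exprVn /sum_bound ltf_pV2 ?posrE; [|exact: K8|exact: mulr_gt0 c0 K6].
have : K%:R ^+ 6 <= (1 + K%:R) ^+ 6 :> R by rewrite lerXn2r ?nnegrE; lra.
have -> : (1 + K%:R) ^+ 8 = (1 + K%:R) ^+ 6 * ((1 + K%:R) * (1 + K%:R)) :> R by ring.
have : 676 <= (1 + K%:R) * (1 + K%:R) :> R by nra.
move: (K%:R ^+ 6 : R) K6 ((1 + K%:R) ^+ 6 : R) ((1 + K%:R) * (1 + K%:R) : R) => a a0 b c bc ab.
nra.
Qed.

(** [kernel_detection] yields an [n] at which the product kernel is not small, and [kernel_small]
    turns this into closeness to integers. The lower bounds on [n1] and [n2] make the decay
    hypothesis on [eps] available at both. *)
Lemma good_pair (K N : nat) (u : nat -> R) : (25 <= K)%N ->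
  (K ^ 112 <= N < K.+1 ^ 112)%N -> ~ bad K u ->
  exists n1 n2, [/\ (n1 + n2 = N)%N, ((K ^ 36) ^ 3 <= n1)%N, ((K ^ 36) ^ 3 <= n2)%N,
    dist_int (u n1) <= K%:R^-1 & dist_int (u n2) <= K%:R^-1].
Proof.
move=> K25 /andP[KN NK] nb.
set M := ((K ^ 36) ^ 3)%N.
have K0 : (0 < K)%N by exact: leq_trans K25.
have M0 : (0 < M)%N by rewrite !expn_gt0 K0.
have MN : (4 * M <= N)%N.
  apply: leq_trans KN; rewrite /M -expnM (_ : 112 = 1 + 36 * 3 + 3)%N// expnD expnD expn1.
  rewrite -[leqLHS]muln1 leq_mul ?expn_gt0 ?K0// leq_mul2r.
  by apply/orP; right; apply: leq_trans K25.
have KR : 25 <= K%:R :> R by rewrite ler_nat.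
have K6 : 0 < K%:R ^+ 6 :> R by rewrite exprn_gt0//; lra.
have c0 : 0 < 600 :> R by rewrite ltr0n.
have b0 : 0 < sum_bound K by rewrite invr_gt0; exact: mulr_gt0 c0 K6.
have [||i j ij|n hn] := @kernel_detection R 'I_M (kernel_degree K)
    (fun n => u (M + n)%N) (fun n => u (N - (M + n))%N) (sum_bound K).
- by rewrite card_ord.
- rewrite /sum_bound mulrAC ler_pdivrMr ?mul1r; last exact: mulr_gt0 c0 K6.
  have -> : (2 * kernel_degree K).+1%:R = 16 * K%:R ^+ 3 + 1 :> R.
    by rewrite -natr1 /kernel_degree mulnA natrM natrX.
  have K3 : 1 <= K%:R ^+ 3 :> R by rewrite exprn_ege1//; lra.
  have -> : K%:R ^+ 6 = K%:R ^+ 3 * K%:R ^+ 3 :> R by ring.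
  nra.
- rewrite card_ord leNgt; apply/negP => lt; apply: nb.
  exists (Ordinal NK, (i, j)); rewrite /bad_at /= KN ij /=.
  by apply: ltW.
have A01 (z : R) : 0 <= cos (pi * z) ^+ 2 <= 1.
  by rewrite sqr_ge0 cos2sin2 gerBl sqr_ge0.
have key (z : R) : sum_bound K <= cos (pi * z) ^+ (2 * kernel_degree K) ->
    dist_int z <= K%:R^-1.
  rewrite exprM => h; have /andP[z0 z1] := A01 z.
  have : 1 - K%:R^-1 ^+ 2 < cos (pi * z) ^+ 2.
    rewrite ltNge; apply/negP; rewrite exprVn => /(kernel_small _ _ K25 z0).
    by rewrite ltNge h.
  have Kp : 0 <= K%:R^-1 :> R by rewrite invr_ge0.
  by move/(near_int_of_cos _ _ Kp) => [k]; exact: dist_int_le.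
(* Since both kernel factors are at most 1, the lower bound on their product passes to each of
   them. *)
have A01' (z : R) : 0 <= cos (pi * z) ^+ (2 * kernel_degree K) <= 1.
  have /andP[z0 z1] := A01 z.
  by rewrite exprM exprn_ge0// exprn_ile1.
have nM := ltn_ord n.
clear KN NK nb; clearbody M.
exists (M + n)%N, (N - (M + n))%N; split; try lia.
- apply: key; apply: (le_trans hn); have /andP[p0 p1] := A01' (u (M + n)%N).
  by rewrite ler_piMr//; have /andP[] := A01' (u (N - (M + n))%N).
- apply: key; apply: (le_trans hn); have /andP[p0 p1] := A01' (u (N - (M + n))%N).
  by rewrite ler_piMl//; have /andP[] := A01' (u (M + n)%N).
Qed.

End exceptional_events.

(** * Exceptional parameters along a line in the family *)

Section one_parameter.
Context {R : realType}.
Let mu := @lebesgue_measure R.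

Let line (f : nat -> R) (b : {poly R}) (s : R) (n : nat) : R := f n + s * b.[n%:R].

Lemma measurable_line f b n : measurable_fun setT (fun s => line f b s n).
Proof.
apply: measurable_funD; first exact: measurable_cst.
by apply: measurable_funM; [exact: measurable_id|exact: measurable_cst].
Qed.

(** [large_values] with [kap = K^36] and [y = kap^3 / (600 * K^6)]: the ratio [kap^8 / y^4] is
    [600^4 * K^24 / kap^4]. The bound is uniform in [f], which enters only the phases [ph]. *)
Lemma measure_bad_at_le (b : {poly R}) : (3 < size b)%N ->
  exists K0 : nat, forall T, 0 < T -> exists2 D : R, 0 < D &
  forall K f (t : bad_index K), (K0 <= K)%N ->
    (mu (`[(- T)%R, T] `&` [set s | bad_at K t (line f b s)]) <=
      (D * K%:R ^+ 24 / (K%:R ^+ 36) ^+ 4)%:E)%E.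
Proof.
move=> /two_point_phase_bounds[c [C [A [X0 [c0 C0 A0 X1 bounds]]]]].
(* [K > X0] puts [M] in the range of [bounds]; [K > 8 * A] gives [A * L * M <= N], because
   [L = 8 * K^3] and [N >= K^4 * M]; [K > 2 / c] gives [2 * kap^4 <= c * M^2]. *)
pose K0 := (Num.truncn (Num.max X0 (Num.max (8 * A) (2 / c)))).+1.
exists (maxn 4 K0) => T T0.
have aux (m n : nat) : (n < m -> m + n <= 4 * m)%N by lia.
have a600 : 0 < 600 :> R by rewrite ltr0n.
pose D0 := 2 * T * (2 + 4 * (1 + C) * (2 / c + 1)) + 1.
have D00 : 0 < D0.
  rewrite ltr_wpDl// !mulr_ge0 ?addr_ge0 ?mulr_ge0 ?addr_ge0 ?divr_ge0//; exact: ltW.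
have [D1 D1E] : exists D1, D1 = D0 * 600 ^+ 4 by exists (D0 * 600 ^+ 4).
have D10 : 0 < D1 by rewrite D1E; exact: mulr_gt0 D00 (exprn_gt0 _ a600).
exists D1 => //.
move=> K f [N [i j]]; rewrite geq_max => /andP[K4 KK0].
have : Num.max X0 (Num.max (8 * A) (2 / c)) < K%:R.
  apply: lt_le_trans (_ : K0%:R <= _); last by rewrite ler_nat.
  exact: truncnS_gt.
rewrite !gt_max => /and3P[KX KA Kc].
have K1 : 1 <= K%:R :> R by rewrite ler1n (leq_trans _ K4).
have Kp : 0 < K%:R :> R by exact: lt_le_trans K1.
rewrite /bad_at /=.
set M := ((K ^ 36) ^ 3)%N; set L := kernel_degree K.
have rhs0 : (0 <= (D1 * K%:R ^+ 24 / (K%:R ^+ 36) ^+ 4)%:E)%E.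
  by rewrite lee_fin divr_ge0 ?exprn_ge0 ?(ltW Kp)// mulr_ge0 ?exprn_ge0 ?(ltW Kp) ?(ltW D10).
have empty (E : set R) : (forall s, ~ E s) -> (mu (`[(- T)%R, T] `&` E) <=
    (D1 * K%:R ^+ 24 / (K%:R ^+ 36) ^+ 4)%:E)%E.
  by move=> E0; rewrite (_ : E = set0); [rewrite setI0 /mu measure0|apply/seteqP; split=> // s /E0].
have [KN|_] := boolP (K ^ 112 <= N)%N; last by apply: empty.
have [ij|_] := boolP ((i != L :> nat) || (j != L :> nat)); last by apply: empty.
rewrite /=.
have K0' : (0 < K)%N by exact: leq_trans K4.
have kap0 : (0 < K ^ 36)%N by rewrite expn_gt0 K0'.
have M0 : (0 < M)%N by rewrite expn_gt0 kap0.
have KM : (K ^ 112 = K ^ 4 * M)%N by rewrite /M -expnM -expnD.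
have MN : (4 * M <= N)%N.
  apply: leq_trans KN; rewrite KM leq_mul2r; apply/orP; right.
  by apply: (leq_trans K4); rewrite -[X in (X <= _)%N]expn1 leq_pexp2l.
have kap1 : K%:R <= K%:R ^+ 36 :> R by rewrite -[leLHS]expr1 ler_weXn2l.
have MR : M%:R = (K%:R ^+ 36) ^+ 3 :> R by rewrite /M !natrX.
have kap_ge1 : 1 <= K%:R ^+ 36 :> R by rewrite exprn_ege1.
have kapM : K%:R ^+ 36 <= M%:R :> R by rewrite MR -[leLHS]expr1 ler_weXn2l.
have LR : L%:R = 8 * K%:R ^+ 3 :> R by rewrite /L /kernel_degree natrM natrX.
have absk (q : 'I_(2 * L).+1) : `|L%:R - q%:R| <= L%:R :> R.
  have q1 : (q <= 2 * L)%N by rewrite -ltnS.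
  have : (q%:R : R) <= 2 * L%:R by rewrite -natrM ler_nat.
  have : (0 : R) <= q%:R by [].
  by rewrite ler_norml; lra.
have ne1 (q : 'I_(2 * L).+1) : (q != L :> nat) -> 1 <= `|L%:R - q%:R| :> R.
  rewrite neq_ltn => /orP[h|h].
    by rewrite -natrB 1?ltnW// normr_nat ler1n subn_gt0.
  by rewrite distrC -natrB 1?ltnW// normr_nat ler1n subn_gt0.
have [|||g1 g1c [H1 H2 H3]] := bounds M N L%:R (L%:R - i%:R) (L%:R - j%:R) _ MN _ (absk i) _.
- by rewrite (le_trans (ltW KX))// (le_trans kap1).
- rewrite LR; apply: (@le_trans _ _ (K ^ 112)%:R); last by rewrite ler_nat.
  rewrite KM natrM natrX ler_wpM2r//.
  rewrite (_ : A * (8 * K%:R ^+ 3) = (8 * A) * K%:R ^+ 3); last by ring.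
  by rewrite exprS ler_wpM2r ?exprn_ge0 ?(ltW Kp)// ltW.
- have [ji|] := eqVneq (j : nat) L; last by move=> /ne1; right.
  by left; rewrite ji subrr; split=> //; move: ij; rewrite ji eqxx orbF; exact: ne1.
set kap := K%:R ^+ 36 in kap1 MR kap_ge1 kapM rhs0 *.
have g1k : 2 * (K ^ 36)%N%:R ^+ 4 <= g1.
  apply: le_trans g1c; rewrite natrX -/kap MR.
  have -> : c * (kap ^+ 3) ^+ 2 = (c * kap ^+ 2) * kap ^+ 4 by ring.
  rewrite ler_wpM2r ?exprn_ge0 ?(le_trans ler01 kap_ge1)//.
  have : 2 <= c * kap.
    move: Kc; rewrite ltr_pdivrMr// mulrC => /ltW h; apply: (le_trans h).
    by rewrite ler_wpM2l// ltW.
  move=> h; rewrite expr2; apply: (le_trans h); rewrite ler_wpM2l ?(ltW c0)//.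
  by rewrite ler_peMr// (le_trans ler01).
have y0 : 0 < sum_bound K * M%:R :> R.
  rewrite mulr_gt0 ?ltr0n// invr_gt0; exact: mulr_gt0 a600 (exprn_gt0 _ Kp).
pose ph n := (L%:R - i%:R) * f (M + n)%N + (L%:R - j%:R) * f (N - (M + n))%N.
have := @large_values R (K ^ 36) _ ph c C g1 T _ kap0 c0 C0 g1k T0 y0 H1 H2 H3.
rewrite -/D0 -/M.
have -> : [set s | sum_bound K * M%:R <= `|pair_sum K N i j (line f b s)| ] =
  [set s | sum_bound K * M%:R <= `|\sum_(n < M) cos (2 * pi *
    (((L%:R - i%:R) * b.[(M + n)%:R] + (L%:R - j%:R) * b.[N%:R - (M + n)%:R]) * s +
      ph n))| ].
  have E s : pair_sum K N i j (line f b s) = \sum_(n < M) cos (2 * pi *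
    (((L%:R - i%:R) * b.[(M + n)%:R] + (L%:R - j%:R) * b.[N%:R - (M + n)%:R]) * s +
      ph n)).
    rewrite /pair_sum; apply: eq_bigr => n _; rewrite /line /ph -/M -/L natrB.
      by congr cos; ring.
    exact: leq_trans (aux _ _ (ltn_ord n)) MN.
  by apply/seteqP; split=> s /=; rewrite E.
move=> h; apply: (le_trans h); rewrite lee_fin le_eqVlt; apply/orP; left; apply/eqP.
rewrite MR natrX -/kap /sum_bound D1E.
have kn : kap != 0 by rewrite gt_eqF// (lt_le_trans ltr01).
have Kn : K%:R != 0 :> R by rewrite gt_eqF.
have n600 : 600 != 0 :> R by rewrite gt_eqF.
clear - kn Kn n600.
move: D0 kap kn (K%:R : R) Kn (600 : R) n600 => D k k0 x x0 z z0.
by field; rewrite k0 x0 z0.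
Qed.

(** Union bound: there are [O(K^112 * K^6)] indices, each contributing [O(K^(24 - 144))], which
    leaves [K^(-2)]. *)
Lemma measure_bad_le (b : {poly R}) : (3 < size b)%N ->
  exists K0 : nat, forall T, 0 < T -> exists2 D : R, 0 < D &
  forall K f, (K0 <= K)%N ->
    (mu (`[(- T)%R, T] `&` [set s | bad K (line f b s)]) <= (D / K%:R ^+ 2)%:E)%E.
Proof.
move=> /measure_bad_at_le[K0 hK]; exists (maxn 1 K0) => T /hK[D D0 {}hK].
have [p pE] : exists p : R, p = 2 ^+ 112 by exists (2 ^+ 112).
have p0 : 0 < p by rewrite pE exprn_gt0.
exists (p * 17 ^+ 2 * D); first by rewrite !mulr_gt0// exprn_gt0.
move=> K f; rewrite geq_max => /andP[K1 KK0].
have Kp : 0 < K%:R :> R by rewrite ltr0n.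
rewrite (_ : _ `&` _ = [set s | exists t : bad_index K,
    (`[(- T)%R, T] `&` [set s | bad_at K t (line f b s)]) s]); last first.
  by apply/seteqP; split=> [s [sT [t st]]|s [t [sT st]]]; [exists t|split=> //; exists t].
apply: (le_trans (@measure_exists_le _ _ _ mu _ _ (D * K%:R ^+ 24 / (K%:R ^+ 36) ^+ 4) _ _)).
- move=> t; apply: measurableI => //; apply: measurable_bad_at => n.
  exact: measurable_line.
- by move=> t; exact: hK.
have -> : #|{: bad_index K}|%:R = K.+1%:R ^+ 112 * (16 * K%:R ^+ 3 + 1) ^+ 2 :> R.
  rewrite !card_prod !card_ord natrM natrX natrM -expr2; congr (_ * _ ^+ 2).
  by rewrite -natr1 /kernel_degree mulnA natrM natrX.
rewrite lee_fin.
have h1 : K.+1%:R ^+ 112 <= p * K%:R ^+ 112.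
  rewrite pE -exprMn lerXn2r ?nnegrE ?mulr_ge0// -natrM ler_nat.
  by rewrite mul2n -addnn -[leqLHS]addn1 leq_add2l.
have h2 : (16 * K%:R ^+ 3 + 1) ^+ 2 <= 17 ^+ 2 * (K%:R ^+ 3) ^+ 2 :> R.
  have K3 : 1 <= K%:R ^+ 3 :> R by rewrite exprn_ege1// ler1n.
  by rewrite -exprMn lerXn2r ?nnegrE; lra.
have q0 : 0 <= D * K%:R ^+ 24 / (K%:R ^+ 36) ^+ 4.
  by rewrite divr_ge0 ?mulr_ge0 ?exprn_ge0// ltW.
apply: (@le_trans _ _ ((p * K%:R ^+ 112) * (17 ^+ 2 * (K%:R ^+ 3) ^+ 2) *
   (D * K%:R ^+ 24 / (K%:R ^+ 36) ^+ 4))).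
  rewrite ler_wpM2r//; exact: ler_pM.
have -> : K%:R ^+ 112 = (K%:R ^+ 28) ^+ 4 :> R by rewrite -exprM.
have -> : K%:R ^+ 36 = K%:R ^+ 28 * K%:R ^+ 8 :> R by rewrite -exprD.
have k28 : K%:R ^+ 28 != 0 :> R by rewrite expf_neq0// gt_eqF.
have Kn : K%:R != 0 :> R by rewrite gt_eqF.
rewrite le_eqVlt; apply/orP; left; apply/eqP.
move: (K%:R ^+ 28 : R) k28 => q k28.
by field; rewrite k28 Kn.
Qed.

(** Induction on the sharper bound [2 - 1 / n] for [n >= 1] terms, which telescopes. *)
Lemma sum_inv_sqr_le n : \sum_(0 <= i < n) (i.+1%:R ^+ 2)^-1 <= 2 :> R.
Proof.
suff : \sum_(0 <= i < n.+1) (i.+1%:R ^+ 2)^-1 <= 2 - n.+1%:R^-1 :> R.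
  rewrite big_nat_recr//= => h; apply: (@le_trans _ _ (2 - n.+1%:R^-1)).
    by apply: le_trans h; rewrite lerDl invr_ge0 sqr_ge0.
  by rewrite gerBl invr_ge0.
elim: n => [|n IH]; first by rewrite big_nat1 expr1n invr1; lra.
rewrite big_nat_recr//=; apply: (le_trans (lerD IH (lexx _))).
have x0 : 0 < n.+1%:R :> R by rewrite ltr0n.
rewrite -[n.+2%:R]natr1; move: (n.+1%:R : R) x0 => x x0.
have -> : 2 - (x + 1)^-1 = 2 - x^-1 + (x * (x + 1))^-1.
  by field; rewrite !gt_eqF//; lra.
rewrite lerD2l lef_pV2 ?posrE ?exprn_gt0 ?mulr_gt0//; nra.
Qed.

(** Borel-Cantelli on each interval [[-(T + 1), T + 1]], where [measure_bad_le] gives a summable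
    bound; these countably many intervals cover the line. *)
Lemma limsup_bad_null (b : {poly R}) f : (3 < size b)%N ->
  mu (lim_sup_set (fun K => [set s | bad K (line f b s)])) = 0%E.
Proof.
move=> /measure_bad_le[K0 hK].
set F := fun K => _.
have mF K : measurable (F K) by apply: measurable_bad => n; exact: measurable_line.
have mlim (H : nat -> set R) : (forall k, measurable (H k)) -> measurable (lim_sup_set H).
  move=> mH; apply: bigcapT_measurable => n.
  by apply: bigcup_measurable => k _; exact: mH.
apply/negligibleP; first exact: mlim.
(* The shift starts the sequence where the measure bound is valid, and makes it at most
   [D / (k + 1)^2]; the limit superior is unaffected. *)
pose G T k := `[(- T.+1%:R)%R, T.+1%:R]%classic `&` F (k + K0.+1)%N.
have mG T k : measurable (G T k) by apply: measurableI.
apply: (@negligibleS _ (measurableTypeR R) R mu (\bigcup_T (lim_sup_set (G T) : set (measurableTypeR R)))).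
  move=> s hs; exists (Num.truncn `|s|) => // n _.
  have [k /= nk Fk] := hs (n + K0.+1)%N I.
  exists (k - K0.+1)%N => /=; first by rewrite leq_subRL ?(leq_trans _ nk) ?leq_addl// addnC.
  rewrite /G subnK ?(leq_trans _ nk) ?leq_addl//; split=> //=.
  by rewrite in_itv /= -ler_norml ltW// truncnS_gt.
apply: negligible_bigcup => T; apply/negligibleP; first exact: mlim.
apply: lim_sup_set_cvg0; first exact: mG.
have T0 : 0 < T.+1%:R :> R by rewrite ltr0n.
have [D D0 hD] := hK _ T0.
apply: (@le_lt_trans _ _ (D * 2)%:E); last exact: ltry.
apply: lime_le; first by apply: is_cvg_nneseries => k _ _; exact: measure_ge0.
apply: nearW => n.
apply: (@le_trans _ _ (\sum_(0 <= k < n) (D * (k.+1%:R ^+ 2)^-1)%:E)%E).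
  apply: lee_sum => k _; apply: (le_trans (hD _ f _)); first by rewrite ltnW// ltn_addl.
  rewrite lee_fin ler_wpM2l ?(ltW D0)// lef_pV2 ?posrE ?exprn_gt0 ?ltr0n ?addnS//.
  by rewrite lerXn2r ?nnegrE// ler_nat ltnS leq_addr.
by rewrite sumEFin lee_fin -mulr_sumr ler_wpM2l ?(ltW D0)// sum_inv_sqr_le.
Qed.

End one_parameter.

(** * Almost every member of the family *)

Section slices.
Context {R : realType}.
Local Notation RT := (measurableTypeR R).

Definition update_tuple {n} (v : n.-tuple RT) (i : 'I_n) (s : R) : n.-tuple RT :=
  [tuple if j == i then s else tnth v j | j < n].

(** Tonelli. If [i] lies in the tail, the head is integrated last and the induction hypothesis
    applies to each section; if [i] is the head, it is integrated first. *)
Lemma lebesgue_tuple_slices {n} (E : set (n.-tuple RT)) (i : 'I_n) :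
  measurable E ->
  (forall v, @lebesgue_measure R [set s | E (update_tuple v i s)] = 0%E) ->
  lebesgue_tuple E = 0%E.
Proof.
elim: n E i => [E []//|n IH E i mE sl].
pose E' := @cons_pair R n @^-1` E.
have mE' : measurable E'.
  by rewrite -[X in measurable X]setTI; exact: measurable_cons_pair.
rewrite -[LHS]/((@lebesgue_measure R \x @lebesgue_tuple R n)%E E').
have [j ij|i0] := unliftP ord0 i.
  rewrite /product_measure1; apply: integral0_eq => x _ /=.
  apply: (IH _ j); first exact: measurable_xsection.
  move=> w; rewrite -[RHS](sl (cons_pair (x, w))); congr (lebesgue_measure _).
  apply/seteqP; split=> s /=; rewrite /xsection /= inE /E' /= ij.
    congr (E _); apply: eq_from_tnth => k; rewrite tnth_mktuple.
    have [k' ->|->] := unliftP ord0 k; last by rewrite tnth0.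
    by rewrite !tnthS tnth_mktuple (inj_eq lift_inj).
  congr (E _); apply: eq_from_tnth => k; rewrite tnth_mktuple.
  have [k' ->|->] := unliftP ord0 k; last by rewrite tnth0.
  by rewrite !tnthS tnth_mktuple (inj_eq lift_inj).
(* Uniqueness of the product measure exchanges the order of integration. *)
rewrite (@product_measure_unique _ _ _ _ _ (@lebesgue_measure R) (@lebesgue_tuple R n)
  (@lebesgue_measure R \x^ @lebesgue_tuple R n)%E)//; last first.
  by move=> A B mA mB; rewrite /= product_measure2E.
rewrite /= /product_measure2; apply: integral0_eq => w _ /=.
(* The head 0 is a placeholder, overwritten by [update_tuple] at position [i]. *)
rewrite -[RHS](sl (cons_pair (0 : RT, w))); congr (lebesgue_measure _).
have h s : cons_pair (s, w) = update_tuple (cons_pair (0 : RT, w)) i s.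
  apply: eq_from_tnth => k; rewrite tnth_mktuple i0.
  by have [k' ->|->] := unliftP ord0 k; [rewrite !tnthS|rewrite tnth0].
by apply/seteqP; split=> s /=; rewrite /ysection /= inE /E' /= -h.
Qed.

End slices.

(** * From a null exceptional set to bases of order 2 *)

Section main.
Context {R : realType}.

Lemma horner_affine_point n (p0 : {poly R}) (b : 'I_n -> {poly R}) t x :
  (affine_point p0 b t).[x] = p0.[x] + \sum_(i < n) tnth t i * (b i).[x].
Proof.
rewrite /affine_point hornerD horner_sum; congr (_ + _).
by apply: eq_bigr => i _; rewrite hornerZ.
Qed.

(** On a slice in the direction of coordinate [i], the base point and the other coordinates form the
    arbitrary function [f] of [limsup_bad_null]. *)
Lemma affine_bad_null n (p0 : {poly R}) (b : 'I_n -> {poly R}) i :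
  (3 < size (b i))%N ->
  (@lebesgue_tuple R n).-negligible (lim_sup_set (fun K =>
    [set t | bad K (fun m => (affine_point p0 b t).[m%:R])])).
Proof.
move=> bi; have mh (m : nat) : measurable_fun [set: n.-tuple (measurableTypeR R)]
    (fun t => (affine_point p0 b t).[m%:R]).
  under eq_fun do rewrite horner_affine_point.
  apply: measurable_funD; first exact: measurable_cst.
  apply: measurable_sum => j; apply: measurable_funM; last exact: measurable_cst.
  exact: measurable_tnth.
have mE : measurable (lim_sup_set (fun K =>
    [set t | bad K (fun m => (affine_point p0 b t).[m%:R])])).
  apply: bigcapT_measurable => k; apply: bigcup_measurable => K _.
  exact: measurable_bad.
apply/negligibleP => //; apply: (lebesgue_tuple_slices _ i) => // v.
rewrite -[RHS](limsup_bad_null (b i)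
  (fun m => p0.[m%:R] + \sum_(j < n | j != i) tnth v j * (b j).[m%:R]) bi).
congr (lebesgue_measure _).
have E s : (fun m => (affine_point p0 b (update_tuple v i s)).[m%:R]) =
   (fun m => p0.[m%:R] + \sum_(j < n | j != i) tnth v j * (b j).[m%:R] + s * (b i).[m%:R]).
  apply/funext => m; rewrite horner_affine_point (bigD1 i)//= tnth_mktuple eqxx.
  rewrite addrAC addrA; congr (_ + _ + _).
  by apply: eq_bigr => j /negPf ji; rewrite tnth_mktuple ji.
apply/seteqP; split=> s /= h k _; have [K kK] := h k I; rewrite /= => bK; exists K => //.
  by rewrite /= -E.
by rewrite /= E.
Qed.

Lemma exists_root (N m : nat) : (0 < m)%N -> exists K, (K ^ m <= N < K.+1 ^ m)%N.
Proof.
move=> m0; have P0 : exists K, (K ^ m <= N)%N by exists 0%N; rewrite exp0n.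
have bnd K : (K ^ m <= N)%N -> (K <= N)%N.
  apply: leq_trans; case: K => // K.
  by rewrite -[X in (X <= _)%N]expn1 leq_pexp2l.
case: (ex_maxnP P0 bnd) => K KN Kmax; exists K; rewrite KN ltnNge.
by apply/negP => /Kmax; rewrite ltnn.
Qed.

(** Eventually [ln (1 / eps n) <= ln n / m], and [n <= K^m] turns the right side into at most
    [ln K]. *)
Lemma eps_lower_bound (eps : nat -> R) (m : nat) : (0 < m)%N ->
  (forall n, 0 < eps n) ->
  ln (1 / eps n) / ln n%:R @[n --> \oo] --> (0 : R) ->
  exists n0, forall K n, (n0 <= n <= K ^ m)%N -> K%:R^-1 <= eps n.
Proof.
move=> m0 eps0 /cvgr0Pnorm_le /(_ m%:R^-1).
have mp : 0 < m%:R :> R by rewrite ltr0n.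
rewrite invr_gt0 mp => /(_ isT) [n0 _ h].
(* From 2 on [ln n] is positive, so the quotient bound can be multiplied out. *)
exists (maxn 2 n0) => K n; rewrite geq_max => /andP[/andP[n2 nn0] nK].
have ln0 : 0 < ln n%:R :> R by rewrite ln_gt0// ltr1n.
have K0 : (0 < K)%N.
  by move: nK n2; case: K => //; rewrite exp0n// leqn0 => /eqP->.
have KR : 0 < K%:R :> R by rewrite ltr0n.
have lnK : ln n%:R <= m%:R * ln K%:R :> R.
  rewrite mulr_natl -lnXn// ler_ln ?posrE ?exprn_gt0 ?ltr0n//; last by rewrite (leq_trans _ n2).
  by rewrite -natrX ler_nat.
have {h} := h n nn0; rewrite /= => /(le_trans (ler_norm _)).
rewrite ler_pdivrMr// => h.
have : ln (1 / eps n) <= ln K%:R.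
  by apply: (le_trans h); rewrite -ler_pdivlMl ?invr_gt0// invrK.
rewrite ler_ln ?posrE ?div1r ?invr_gt0// => h'.
by rewrite -[eps n]invrK lef_pV2 ?posrE ?invr_gt0.
Qed.

Lemma basis_of_eventually_good (eps : nat -> R) (p : {poly R}) :
  (forall n, 0 < eps n) ->
  ln (1 / eps n) / ln n%:R @[n --> \oo] --> (0 : R) ->
  ~ lim_sup_set (fun K => [set p | bad K (fun m => p.[m%:R])]) p ->
  basis_of_order2 (small_dist_set eps p).
Proof.
move=> eps0 heps nE.
(* The exponent is [2 * 112]: for large [K], [N < (K + 1)^112 <= (K^2)^112], so both summands are at
   most [K^224]. *)
have [n0 n0P] := eps_lower_bound eps 224 isT eps0 heps.
have [k0 k0P] : exists k0, forall K, (k0 <= K)%N -> ~ bad K (fun m => p.[m%:R]).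
  apply: contrapT => /forallNP h; apply: nE => k _ /=.
  have /existsNP[K /not_implyP[kK /contrapT bK]] := h k; by exists K.
pose k1 := maxn 25 (maxn n0 k0).
exists (k1.+1 ^ 112)%N => // N /= kN.
have [K /andP[KN NK]] := exists_root N 112 isT.
have : (k1 <= K)%N.
  have := leq_ltn_trans kN NK; rewrite ltn_exp2r// ltnS => /ltnW; exact.
rewrite !geq_max => /and3P[K25 Kn0 Kk0].
have KNK : (K ^ 112 <= N < K.+1 ^ 112)%N by rewrite KN.
have [n1 [n2 [n12 M1 M2 d1 d2]]] := good_pair _ _ _ K25 KNK (k0P _ Kk0).
have KM : (K <= (K ^ 36) ^ 3)%N.
  rewrite -expnM -[X in (X <= _)%N]expn1 leq_pexp2l//.
  exact: leq_trans K25.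
have NK2 : (N <= K ^ 224)%N.
  apply: (leq_trans (ltnW NK)); rewrite (_ : 224 = 2 * 112)%N// expnM.
  rewrite leq_exp2r//; apply: (@leq_trans (2 * K)%N).
    by rewrite mul2n -addnn -addn1 leq_add2l (leq_trans _ K25).
  by rewrite -mulnn leq_mul2r (leq_trans _ K25)// orbT.
exists n1.
  rewrite /small_dist_set /=; apply: (le_trans d1); apply: n0P.
  rewrite (leq_trans Kn0 (leq_trans KM M1)) (leq_trans _ NK2)//.
  by rewrite -n12 leq_addr.
exists n2 => //; rewrite /small_dist_set /=; apply: (le_trans d2); apply: n0P.
rewrite (leq_trans Kn0 (leq_trans KM M2)) (leq_trans _ NK2)//.
by rewrite -n12 leq_addl.
Qed.

(** Some [p] has degree at least 3, and the failure of the second alternative at this [p] gives [q]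
    with [deg (p - q) >= deg p]. As [p - q] is a combination of the [b i], one of them has degree at
    least 3. *)
Lemma exists_direction_size_gt3 (P : set {poly R}) n (p0 : {poly R})
    (b : 'I_n -> {poly R}) : P = range (affine_point p0 b) ->
  ~ (forall p, P p -> (size p <= 3)%N) ->
  ~ (exists2 p, P p & forall q, P q -> (size (p - q)%R < size p)%N) ->
  exists i, (3 < size (b i))%N.
Proof.
move=> PE n1 n2; have /existsNP[p /not_implyP[Pp /negP]] := n1.
rewrite -ltnNge => p3.
have [q /not_implyP[Pq /negP]] : exists q, ~ (P q -> (size (p - q)%R < size p)%N).
  by apply/existsNP => h; apply: n2; exists p.
rewrite -leqNgt => /(leq_trans p3) pq.
apply: contrapT => /forallNP small.
move: Pp Pq pq; rewrite PE => -[s _ <-] [t _ <-].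
have -> : affine_point p0 b s - affine_point p0 b t =
    \sum_(i < n) (tnth s i - tnth t i) *: b i.
  rewrite /affine_point opprD addrACA subrr add0r -sumrB.
  by apply: eq_bigr => i _; rewrite scalerBl.
rewrite ltnNge => /negP; apply; apply: (leq_trans (size_sum _ _ _)).
apply/bigmax_leqP => i _; apply: (leq_trans (size_scale_leq _ _)).
by rewrite leqNgt; apply/negP; exact: small.
Qed.

End main.

(** Degrees are expressed by [size], which is the degree plus one and is 0 for the zero polynomial;
    strict comparison of sizes thus agrees with the convention [deg 0 = -oo]. *)
Theorem theorem3p1 (R : realType) (P : set {poly R}) (eps : nat -> R)
  (hP : findim_affine_family P)
  (eps_gt0 : forall n, 0 < eps n)
  (heps : ln (1 / eps n) / ln n%:R @[n --> \oo] --> (0 : R)) :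
  [\/ forall p, P p -> (size p <= 3)%N,
      exists2 p, P p & forall q, P q -> (size (p - q)%R < size p)%N
    | haar_almost_all P (fun p => basis_of_order2 (small_dist_set eps p))].
Proof.
have [h1|n1] := pselect (forall p, P p -> (size p <= 3)%N); first exact: Or31.
have [h2|n2] := pselect (exists2 p, P p & forall q, P q -> (size (p - q)%R < size p)%N).
  exact: Or32.
apply: Or33 => n p0 b [_ PE].
have [i bi] := exists_direction_size_gt3 P n p0 b PE n1 n2.
(* A parameter whose set is not a basis must be bad for infinitely many [K], hence lies in the null
   limit superior. *)
apply: negligibleS (affine_bad_null n p0 b i bi) => t /= nb.
apply: contrapT => nE; apply: nb; apply: basis_of_eventually_good => //.
Qed.
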